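(* For $n\ge1$ let $\tau_n$ be a uniformly random recursive tree with $n$ vertices and $T_n=\mathrm{Cut}(\tau_n)$ its cut-tree. Let $\pi(n)=1/[n(n+1)]$, $n\ge1$, and let $(X_n,\vartheta_n)_{n\ge0}$ be i.i.d. where $X_n\sim\pi$ and, given $X_n=\ell$, $\vartheta_n$ is a uniformly random recursive tree with $\ell$ vertices. Let $T_\infty$ be the tree obtained from an infinite branch by attaching, for each $n\ge0$, an independent cut-tree $\mathrm{Cut}(\vartheta_n)$ by an edge (joining its root) to the vertex of the branch at height $n$. Then $T_n$ converges in distribution to $T_\infty$ with respect to the local limit topology as $n\to\infty$.
   Context: Trees (other than the labelled trees being cut) are rooted, unordered, with finite numbers of children, identified up to root- and parent-preserving bijections. For an integer $R\ge0$, $t|_R$ is the subtree of vertices at graph distance at most $R$ from the root; the local limit topology is induced by $d_{\mathrm{loc}}(t,s)=\exp[-\inf\{R\ge0:t|_R\ne s|_R\}]$. A recursive tree with $n$ vertices is a tree with vertices labelled $1,\dots,n$ such that the labels along the shortest path from $1$ to any given leaf are increasing. Cut-tree of a finite (labelled) tree $\tau$: a random rooted binary unordered tree $\mathrm{Cut}(\tau)$ defined recursively. If $\tau$ has a single vertex, $\mathrm{Cut}(\tau)$ is the single-vertex tree. Otherwise pick an edge of $\tau$ uniformly at random and remove it, let $\tau_1,\tau_2$ be the two resulting sub-trees, and let $\mathrm{Cut}(\tau)$ be the tree obtained by attaching the roots of $\mathrm{Cut}(\tau_1)$ and $\mathrm{Cut}(\tau_2)$ (built independently given $\tau_1,\tau_2$)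 by edges to a new common root. The infinite branch is the infinite path $v_0,v_1,v_2,\dots$ rooted at $v_0$, with $v_n$ at height $n$. *)

(* Defs.v *)
From HB Require Import structures.
From mathcomp Require Import all_boot all_order all_algebra finmap.
From mathcomp Require Import all_classical all_reals all_analysis.

Set Implicit Arguments.
Unset Strict Implicit.
Unset Printing Implicit Defensive.

Import Order.TTheory GRing.Theory Num.Theory.
Import numFieldNormedType.Exports.

Local Open Scope ring_scope.
Local Open Scope quotient_scope.

Section LabelledGraphs.
Variable V : finType.

(* A graph on a subset of [V]: its vertices, and its edges as unordered
   pairs. *)
Definition lgraph : Type := ({set V} * {set {set V}})%type.

Definition adj (E : {set {set V}}) : rel V :=
  fun x y => (x != y) && ([set x; y] \in E).

Definition is_tree (G : lgraph) : Prop :=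
  [/\ (0 < #|G.1|)%N,
      forall e, e \in G.2 -> (#|e| = 2)%N /\ e \subset G.1,
      {in G.1 &, forall x y, connect (adj G.2) x y} &
      forall c, ucycle (adj G.2) c -> (size c <= 2)%N].

Definition shortest_path (e : rel V) (x y : V) (p : seq V) : Prop :=
  [/\ path e x p, last x p = y &
      forall q, path e x q -> last x q = y -> (size p <= size q)%N].

Definition is_leaf (G : lgraph) (x : V) : bool :=
  (x \in G.1) && (#|[set y | adj G.2 x y]| <= 1)%N.

Definition component (G : lgraph) (x : V) : {set V} :=
  [set y in G.1 | connect (adj G.2) x y].

Definition induced_subgraph (G : lgraph) (C : {set V}) : lgraph :=
  (C, [set f in G.2 | f \subset C]).

(* The two components left after removing an edge [e] of a tree [G], in the
   order in which they happen to be enumerated. *)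
Definition cut_parts (G : lgraph) (e : {set V}) : lgraph * lgraph :=
  let G' := (G.1, G.2 :\ e) in
  let s := enum [set component G' x | x in G.1] in
  (induced_subgraph G' (nth finset.set0 s 0),
   induced_subgraph G' (nth finset.set0 s 1)).

End LabelledGraphs.

(* The vertex [i : 'I_n] carries the label [i + 1]. *)
Definition is_recursive_tree n (G : lgraph 'I_n) : Prop :=
  [/\ G.1 = [set: 'I_n]%SET, is_tree G &
      forall (r x : 'I_n) (p : seq 'I_n), r = 0%N :> nat -> is_leaf G x ->
        shortest_path (adj G.2) r x p ->
        path (fun i j : 'I_n => (i < j)%N) r p].

Definition recursive_trees n : {set lgraph 'I_n} :=
  [set G | `[< is_recursive_tree G >]].

(* Graphs labelled by an initial segment of arbitrary length, as a discrete
   measurable space. *)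
Definition labelled_graph : Type := {n : nat & lgraph 'I_n}.

HB.instance Definition _ := Choice.on labelled_graph.
HB.instance Definition _ := isPointed.Build labelled_graph
  (Tagged (fun n => lgraph 'I_n) ((finset.set0, finset.set0) : lgraph 'I_0)).
HB.instance Definition _ := @isMeasurable.Build default_measure_display
  labelled_graph discrete_measurable
  discrete_measurable0 discrete_measurableC discrete_measurableU.

Definition labelled n (G : lgraph 'I_n) : labelled_graph :=
  Tagged (fun m => lgraph 'I_m) G.

Local Open Scope classical_set_scope.

(* Rooted locally finite trees in Ulam-Harris form: vertices are words, the
   root is the empty word, and the children of [u] are the vertices
   [rcons u i]. *)
Record uhtree := UHTree {
  uhv : set (seq nat);
  uh_root : uhv [::];
  uh_parent : forall u i, uhv (rcons u i) -> uhv u;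
  uh_finite : forall u, finite_set [set i | uhv (rcons u i)] }.

HB.instance Definition _ := gen_eqMixin uhtree.
HB.instance Definition _ := gen_choiceMixin uhtree.

(* The root is its own parent by convention. *)
Definition parent (u : seq nat) : seq nat := take (size u).-1 u.

Definition uh_iso (t s : uhtree) : Prop :=
  exists phi : seq nat -> seq nat,
    [/\ set_bij (uhv t) (uhv s) phi, phi [::] = [::] &
        forall u, uhv t u -> phi (parent u) = parent (phi u)].

Lemma parent_rcons u i : parent (rcons u i) = u.
Proof. by rewrite /parent size_rcons/= -cats1 take_size_cat. Qed.

Lemma uh_parentV (t : uhtree) u : uhv t u -> uhv t (parent u).
Proof.
case/lastP: u => [//|u i] tu; rewrite parent_rcons; exact: uh_parent tu.
Qed.

Lemma uh_iso_refl t : uh_iso t t.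
Proof.
exists id; split=> //; split=> [u|u v _ _|u tu] //; by exists u.
Qed.

Lemma uh_iso_sym t s : uh_iso t s -> uh_iso s t.
Proof.
move=> [phi [[fphi iphi sphi] phi0 phip]].
have /choice[psi psiP] v : exists u, uhv s v -> uhv t u /\ phi u = v.
  have [sv|] := pselect (uhv s v); last by exists [::].
  by have [u tu <-] := sphi _ sv; exists u.
have inj u u' : uhv t u -> uhv t u' -> phi u = phi u' -> u = u'.
  by move=> tu tu'; apply: iphi; rewrite inE.
exists psi; split.
- split=> [v sv|v v'|u tu].
  + by have [] := psiP _ sv.
  + rewrite !inE => /psiP[_ {2}<-] /psiP[_ {2}<-] -> //.
  + have su := fphi _ tu; exists (phi u) => //.
    by have [tp pp] := psiP _ su; apply: inj.
- have [tp pp] := psiP _ (uh_root s).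
  by apply: inj => //; [exact: uh_root|rewrite pp phi0].
- move=> v sv; have [tv pv] := psiP _ sv.
  have [tw pw] := psiP _ (uh_parentV sv).
  by apply: inj => //; [exact: uh_parentV|rewrite pw phip// pv].
Qed.

Lemma uh_iso_trans t s r : uh_iso t s -> uh_iso s r -> uh_iso t r.
Proof.
move=> [f [bf f0 fp]] [g [bg g0 gp]]; exists (g \o f); split=> /=.
- exact: set_bij_comp bf bg.
- by rewrite f0.
- by move=> u tu; rewrite fp// gp//; case: bf => ff _ _; apply: ff.
Qed.

Definition uh_isob : rel uhtree := fun t s => `[< uh_iso t s >].

Lemma uh_isob_equiv : equiv_class_of uh_isob.
Proof.
split=> [t|t s|s t r].
- exact/asboolP/uh_iso_refl.
- by apply/asboolP/asboolP; exact: uh_iso_sym.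
- by move=> /asboolP ts /asboolP sr; apply/asboolP/(uh_iso_trans ts).
Qed.

Canonical uh_isob_rel := EquivRelPack uh_isob_equiv.

(* Rooted unordered locally finite trees, up to isomorphism. *)
Definition tree : Type := {eq_quot uh_isob_rel}.

HB.instance Definition _ := Choice.on tree.

Lemma uh_iso_size t s phi u : set_bij (uhv t) (uhv s) phi ->
  phi [::] = [::] -> (forall u, uhv t u -> phi (parent u) = parent (phi u)) ->
  uhv t u -> size (phi u) = size u.
Proof.
move=> [_ iphi _] phi0 phip; elim/last_ind: u => [|u i IH] tui.
  by rewrite phi0.
have tu := uh_parent tui; have := phip _ tui; rewrite parent_rcons => pe.
rewrite size_rcons -(IH tu) pe /parent size_take.
case E : (phi (rcons u i)) => [|a l] /=; last by rewrite leqnn.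
suff : rcons u i = [::] by case: (u).
apply: iphi; rewrite ?inE //; first exact: uh_root.
by rewrite E phi0.
Qed.

Lemma finite_level (t : uhtree) R :
  finite_set [set u | uhv t u /\ (size u <= R)%N].
Proof.
elim: R => [|R IH].
  apply: (@sub_finite_set _ _ [set [::]]); last exact: finite_set1.
  by move=> [|a l] //= [].
apply: (@sub_finite_set _ _ ([set [::]] `|`
   \bigcup_(u in [set u | uhv t u /\ (size u <= R)%N])
     (rcons u @` [set i | uhv t (rcons u i)]))).
  move=> u [tu]; case/lastP: u tu => [|u i] tu su; first by left.
  right; exists u; last by exists i.
  by split; [exact: uh_parent tu|rewrite size_rcons in su].
rewrite finite_setU; split; first exact: finite_set1.
apply: bigcup_finite => // u _; apply: finite_image; exact: uh_finite.
Qed.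

Section Truncation.
Variables (R : nat) (t : uhtree).

Let v := [set u | uhv t u /\ (size u <= R)%N].

Let v0 : v [::]. Proof. by split=> //; exact: uh_root. Qed.

Let vp u i : v (rcons u i) -> v u.
Proof.
move=> [tu su]; split; first exact: uh_parent tu.
by rewrite size_rcons in su; exact: ltnW.
Qed.

Let vf u : finite_set [set i | v (rcons u i)].
Proof. by apply: sub_finite_set (uh_finite t u) => i []. Qed.

Definition uh_trunc := UHTree v0 vp vf.

End Truncation.

Section SingleVertex.

Let v := [set [::] : seq nat].

Let v0 : v [::]. Proof. by []. Qed.

Let vp u i : v (rcons u i) -> v u. Proof. by case: u. Qed.

Let vf u : finite_set [set i | v (rcons u i)].
Proof. by apply: (@sub_finite_set _ _ set0) => // i; case: u. Qed.

Definition uh_leaf := UHTree v0 vp vf.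

End SingleVertex.

Section Join.
Variables t s : uhtree.

Let v := [set u : seq nat | match u with
  | [::] => True
  | 0 :: u' => uhv t u'
  | 1 :: u' => uhv s u'
  | _ => False
  end].

Let v0 : v [::]. Proof. by []. Qed.

Let vp u i : v (rcons u i) -> v u.
Proof. by case: u => [|[|[|k]] u] //=; exact: uh_parent. Qed.

Let vf u : finite_set [set i | v (rcons u i)].
Proof.
case: u => [|[|[|k]] u] /=; [|exact: uh_finite|exact: uh_finite|].
- apply: (@sub_finite_set _ _ [set` [:: 0; 1]%N]); last exact: finite_seq.
  by move=> [|[|k]].
- exact: finite_set0.
Qed.

Definition uh_join := UHTree v0 vp vf.

End Join.

(* The infinite branch consists of the words [nseq n 0]; the tree [C n] hangs
   from it with its root at [nseq n 0 ++ [:: 1]]. *)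
Fixpoint branchv (C : nat -> uhtree) (u : seq nat) : Prop :=
  match u with
  | [::] => True
  | 0 :: u' => branchv (fun n => C n.+1) u'
  | 1 :: u' => uhv (C 0) u'
  | _ => False
  end.

Lemma branchvP C u : branchv C u <->
  (exists n, u = nseq n 0%N) \/
  (exists n u', uhv (C n) u' /\ u = nseq n 0%N ++ 1%N :: u').
Proof.
split.
  elim: u C => [|[|[|k]] u IH] C //=; first by left; exists 0%N.
    move=> /IH[[n ->]|[n [u' [Cu ->]]]]; first by left; exists n.+1.
    by right; exists n.+1, u'.
  by move=> Cu; right; exists 0%N, u.
case=> [[n ->]|[n [u' [Cu ->]]]]; first by elim: n C => //=.
by elim: n C Cu => //= n IH C /(IH (fun n => C n.+1)).
Qed.

Section Branch.
Variable C : nat -> uhtree.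

Let vp u i : branchv C (rcons u i) -> branchv C u.
Proof.
elim: u C => [|[|[|k]] u IH] C' //=; [exact: IH|exact: uh_parent].
Qed.

Let vf u : finite_set [set i | branchv C (rcons u i)].
Proof.
elim: u C => [|[|[|k]] u IH] C' /=; [|exact: IH|exact: uh_finite|].
- apply: (@sub_finite_set _ _ [set` [:: 0; 1]%N]); last exact: finite_seq.
  by move=> [|[|k]].
- exact: finite_set0.
Qed.

Definition uh_branch := @UHTree [set u | branchv C u] I vp vf.

End Branch.

(* All operations below are compatible with [uh_iso], so that the choice of
   representatives is immaterial. *)
Definition trunc (R : nat) (t : tree) : tree := \pi_tree (uh_trunc R (repr t)).
Definition tleaf : tree := \pi_tree uh_leaf.
(* The tree whose root has two children, the roots of [t] and [s]. *)
Definition tjoin (t s : tree) : tree := \pi_tree (uh_join (repr t) (repr s)).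
Definition tbranch (C : nat -> tree) : tree :=
  \pi_tree (uh_branch (fun n => repr (C n))).

Lemma ultra_finite_value (I : Type) (T : choiceType) (U : set_system I)
    (f : I -> T) (B : set T) : UltraFilter U -> finite_set B ->
  U [set i | B (f i)] -> exists2 v, B v & U [set i | f i = v].
Proof.
move=> UU /finite_fsetP[D ->] UD; have PU : ProperFilter U by exact: ultra_proper.
have FU : Filter U := @filter_filter _ _ PU.
have UI A C : U A -> U C -> exists i, A i /\ C i.
  by move=> UA UC; have [i] := @filter_ex _ U PU _ (@filterI _ U FU _ _ UA UC); exists i.
apply: contrapT => /forall2NP nv.
have UC : U (\bigcap_(v in [set` D]) (~` [set i | f i = v])).
  apply: filter_bigI => v vD; have [//|nU] := nv v.
  by have [] := in_ultra_setVsetC [set i | f i = v] UU.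
by have [i [iD /(_ _ iD)]] := UI _ _ UD UC; apply.
Qed.

Lemma uh_iso_trunc t s : (forall R, uh_iso (uh_trunc R t) (uh_trunc R s)) ->
  uh_iso t s.
Proof.
move=> /choice[phi iphi].
have [U [UU subU]] := @ultraFilterLemma _ (\oo : set_system nat) _.
have PU : ProperFilter U by exact: ultra_proper.
have FU : Filter U := @filter_filter _ _ PU.
have UI A C : U A -> U C -> U (A `&` C) := @filterI _ U FU A C.
have UX A : U A -> exists i, A i := @filter_ex _ U PU A.
have Usize k : U [set R | (k <= R)%N] by apply: subU; exists k.
have sz R u : uhv t u -> (size u <= R)%N -> size (phi R u) = size u.
  by move=> tu uR; have [b p0 pp] := iphi R; apply: uh_iso_size b p0 pp _.
have im R u : uhv t u -> (size u <= R)%N -> uhv s (phi R u).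
  by move=> tu uR; have [[fp _ _] _ _] := iphi R; have [] := fp u (conj tu uR).
have /choice[psi psiP] u : exists v, uhv t u ->
    uhv s v /\ U [set R | phi R u = v].
  have [tu|] := pselect (uhv t u); last by exists [::].
  have [|v [sv _] Uv] := @ultra_finite_value _ _ U (phi^~ u) _ UU
    (finite_level s (size u)); last by exists v.
  apply: filterS (Usize (size u)) => R uR /=.
  by rewrite sz//; split=> //; exact: im.
exists psi; split.
- split.
  + by move=> u tu; have [] := psiP u tu.
  + move=> u u'; rewrite !inE => tu tu' e.
    have /UX[R /= [[p q] [uR uR']]] :=
      UI _ _ (UI _ _ (psiP u tu).2 (psiP u' tu').2)
              (UI _ _ (Usize (size u)) (Usize (size u'))).
    have [[_ ip _] _ _] := iphi R.
    by apply: ip; rewrite ?inE//= p q.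
  + move=> v sv.
    have /choice[g gP] R : exists u, (size v <= R)%N ->
        [/\ uhv t u, (size u <= size v)%N & phi R u = v].
      have [vR|] := boolP (size v <= R)%N; last by exists [::].
      have [[_ _ sp] _ _] := iphi R.
      have [u [tu uR] <-] := sp v (conj sv vR).
      by exists u => _; rewrite sz.
    have [|u [tu _] Uu] := @ultra_finite_value _ _ U g _ UU
      (finite_level t (size v)).
      by apply: filterS (Usize (size v)) => R /gP[].
    exists u => //; have /UX[R /= [[p q] vR]] :=
      UI _ _ (UI _ _ (psiP u tu).2 Uu) (Usize (size v)).
    by have [_ _] := gP R vR; rewrite q p.
- have /UX[R /= <-] := (psiP _ (uh_root t)).2.
  by have [_ ->] := iphi R.
- move=> u tu; have tp := uh_parentV tu.
  have /UX[R /= [[p q] uR]] :=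
    UI _ _ (UI _ _ (psiP u tu).2 (psiP _ tp).2) (Usize (size u)).
  by have [_ _ pp] := iphi R; rewrite -p -q; apply: pp.
Qed.

(* The space of trees, indexed by the real numbers in which distances are
   taken. *)
Definition ltree (R : realType) : Type := tree.

Section LocalDistance.
Variable R : realType.
Implicit Types t s r : ltree R.

Definition dloc t s : R := fine (expeR (- ereal_inf
  [set (k%:R)%:E | k in [set k : nat | trunc k t <> trunc k s]])).

Lemma dloc_ge k t s : trunc k t <> trunc k s -> expR (- k%:R) <= dloc t s.
Proof.
move=> ts; rewrite /dloc; set S := [set _ | _ in _].
have Sk : (ereal_inf S <= k%:R%:E)%E by apply: ereal_inf_lbound; exists k.
have S0 : (0 <= ereal_inf S)%E.
  by apply: le_ereal_inf_tmp => _ [j _ <-]; rewrite lee_fin.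
by case: (ereal_inf S) Sk S0 => //= x; rewrite !lee_fin ler_expR lerN2.
Qed.

Lemma dloc_le k t s : (forall j, trunc j t <> trunc j s -> (k <= j)%N) ->
  dloc t s <= expR (- k%:R).
Proof.
move=> tsk; rewrite /dloc; set S := [set _ | _ in _].
have : (k%:R%:E <= ereal_inf S)%E.
  by apply: le_ereal_inf_tmp => _ [j /tsk kj <-]; rewrite lee_fin ler_nat.
by case: (ereal_inf S) => //= x; rewrite lee_fin ler_expR lerN2.
Qed.

Lemma dloc_eq0 t s : (forall j, trunc j t = trunc j s) -> dloc t s = 0.
Proof.
move=> ts; rewrite /dloc (_ : [set _ | _ in _] = set0) ?ereal_inf0//.
by rewrite -subset0 => _ [j /= h _]; exact: h (ts j).
Qed.

Lemma dlocxx t : dloc t t = 0. Proof. exact: dloc_eq0. Qed.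

Lemma dloc_sym t s : dloc t s = dloc s t.
Proof.
rewrite /dloc; congr (fine (expeR (- ereal_inf _)%E)).
by apply/seteqP; split=> _ [j ts <-]; exists j => //= /esym.
Qed.

Lemma dloc_ge0 t s : 0 <= dloc t s.
Proof. by rewrite /dloc fine_ge0// expeR_ge0. Qed.

Lemma dloc_triangle s t r : dloc t r <= dloc t s + dloc s r.
Proof.
have [|] := pselect (forall j, trunc j t = trunc j r).
  by move=> tr; rewrite dloc_eq0// addr_ge0// dloc_ge0.
move=> /existsNP[k0 k0P].
have [k /asboolP kP kmin] := ex_minnP (ex_intro (fun k =>
  `[< trunc k t <> trunc k r >]) k0 (asboolT k0P)).
apply: (@le_trans _ _ (expR (- k%:R))).
  by apply: dloc_le => j /asboolP; exact: kmin.
have [ts|ts] := pselect (trunc k t = trunc k s).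
  by rewrite ler_wpDl ?dloc_ge0// dloc_ge// -ts.
by rewrite ler_wpDr ?dloc_ge0// dloc_ge.
Qed.

Lemma dloc_positivity t s : dloc t s = 0 -> t = s.
Proof.
move=> d0; have ts k : trunc k t = trunc k s.
  apply: contrapT => /dloc_ge; rewrite d0 leNgt expR_gt0//.
rewrite -[t](@reprK _ tree) -[s](@reprK _ tree).
apply/eqmodP/asboolP/uh_iso_trunc => k.
by have /eqmodP/asboolP := ts k.
Qed.

HB.instance Definition _ := Choice.on (ltree R).
HB.instance Definition _ := isPointed.Build (ltree R) tleaf.
HB.instance Definition _ := isMetric.Build R (ltree R)
  dlocxx dloc_positivity dloc_sym dloc_triangle.

End LocalDistance.

Section CutTree.
Variables (R : realType) (V : finType).
Implicit Type G : lgraph V.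

(* [cut_expect_rec m G f] is the expectation of [f (Cut G)]: the sum runs over
   the removed edge, and the nested expectations express the independence of
   the cut-trees of the two parts. The parts of a tree being smaller than the
   tree, the fuel [m] never runs out when [m >= #|G.1|]. *)
Fixpoint cut_expect_rec (m : nat) G (f : tree -> R) : R :=
  if m is m'.+1 then
    if (#|G.1| <= 1)%N then f tleaf else
    (\sum_(e in G.2)
       cut_expect_rec m' (cut_parts G e).1 (fun t =>
         cut_expect_rec m' (cut_parts G e).2 (fun s => f (tjoin t s))))
    / #|G.2|%:R
  else f tleaf.

Definition cut_expect G (f : tree -> R) : R := cut_expect_rec #|G.1| G f.

(* The probability that the cut-tree of [G] belongs to [A]. *)
Definition cut_prob G (A : set tree) : R := cut_expect G \1_A.

End CutTree.
Arguments cut_expect {R V}.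
Arguments cut_prob {R V}.

Definition rrt_pmf (R : realType) n (G : lgraph 'I_n) : R :=
  if G \in recursive_trees n then #|recursive_trees n|%:R^-1 else 0.

(* This vanishes at 0 since [0^-1 = 0]. *)
Definition size_pmf (R : realType) (n : nat) : R := (n * n.+1)%:R^-1.

Definition borel (S : ptopologicalType) : Type := g_sigma_algebraType (@open S).

Section Probability.
Local Open Scope ereal_scope.

Definition mutually_independent d d' (Omega : measurableType d)
    (E : measurableType d') (R : realType) (P : probability Omega R)
    (I : choiceType) (Y : I -> Omega -> E) : Prop :=
  forall (J : {fset I}) (A : I -> set E), (forall i, measurable (A i)) ->
    P (\bigcap_(i in [set` J]) Y i @^-1` A i) =
    \prod_(i <- J) P (Y i @^-1` A i).

Definition cvg_in_distribution (R : realType) (S : ptopologicalType)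
    (d : nat -> measure_display) (Omega : forall n, measurableType (d n))
    (P : forall n, probability (Omega n) R) (X : forall n, Omega n -> S)
    dlim (Omegalim : measurableType dlim) (Plim : probability Omegalim R)
    (Xlim : Omegalim -> S) : Prop :=
  [/\ \forall n \near \oo, measurable_fun setT (X n : Omega n -> borel S),
      measurable_fun setT (Xlim : Omegalim -> borel S) &
      forall f : S -> R, continuous f -> (exists M : R, forall x, `|f x| <= M)%R ->
        'E_(P n)[f \o X n] @[n --> \oo] --> 'E_Plim[f \o Xlim]].

End Probability.

(* Main.v *)
Require Import Defs.
From HB Require Import structures.
From mathcomp Require Import all_boot all_order all_algebra finmap.
From mathcomp Require Import all_classical all_reals all_analysis.
From mathcomp Require Import measurable_realfun lra ring zify.

Set Implicit Arguments.
Unset Strict Implicit.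
Unset Printing Implicit Defensive.

Import Order.TTheory GRing.Theory Num.Theory.
Import numFieldNormedType.Exports.

(** The proof rests on the splitting property of random recursive trees.
Removing a uniform edge from a uniform recursive tree with [n] vertices leaves
two parts which, given the size [k] of the part without the root, are
independent uniform recursive trees with [k] and [n - k] vertices, and [k] has
probability [n / ((n - 1) * k * (k + 1))], which is [split_weight n k]. Hence
the law of [T_n] satisfies
  [E f(T_n) = \sum_(1 <= k < n) split_weight n k * E f(tjoin T_(n-k) T'_k)]
with [T'] an independent copy. This recursion is taken as the definition of
[split_expect], and [sum_rrt_pmf] proves that it gives the law of the cut-tree.

That identity is proved for recursive trees on an arbitrary set of labels, by
induction on the number of labels ([sum_cut]); this way the two parts never
have to be relabelled. Recursive trees on [A] with root [r] are encoded by their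
parent functions ([parent_maps r A], [recursive_treesE]), and the sum over a
tree and one of its edges is rearranged ([sum_cut_pairs]) into a sum over the
label set [B] of the part without the root, a tree on [B], a tree on
[A :\: B], and the upper endpoint [a] of the removed edge. The only constraint
on [a] is that it is smaller than every label of [B]. The pairs [(B, a)] with
[#|B| = k] are the [(k + 1)]-subsets of [A], with their least element marked,
which is where [split_weight] comes from ([card_pointed], [binomial_weight]).

As [n] tends to infinity, [split_weight n k] tends to [1 / (k * (k + 1))] and
[T_(n-k)] should have the same limit as [T_n]. So the limit law has to satisfy
[E f(T) = \sum_k 1 / (k * (k + 1)) * E f(tjoin T T'_k)], which is the recursion
obtained from [T_oo] by separating the first vertex of the infinite branch
([tbranchS]). The heights of the parts are one less than the height of the
whole ([trunc_tjoin]), so for functions of the tree cut at height [k] the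
convergence follows by induction on [k] and dominated convergence of series
([split_expect_cvg], [integral_branch]).

Every bounded continuous function is the increasing limit of its infima
over the cylinders of height [k], which are functions of the tree cut at height
[k]. This gives a lower bound for the limit of the expectations of a nonnegative
[f], and applying it to [f + M] and to [M - f] gives convergence
([lower_limit], [expectation_cvg]). *)

Local Open Scope ring_scope.

(** * Trees cut at a given height *)

Section CutTrees.
Local Open Scope classical_set_scope.
Local Open Scope quotient_scope.
Local Open Scope ring_scope.

Lemma pi_treeE t s : (\pi_tree t = \pi_tree s) <-> uh_iso t s.
Proof. by split=> [/eqmodP/asboolP|ts] //; apply/eqmodP/asboolP. Qed.

Lemma repr_pi_iso t : uh_iso (repr (\pi_tree t)) t.
Proof. by apply/pi_treeE; rewrite reprK. Qed.

Lemma tree_pi (t : tree) : exists u, t = \pi_tree u.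
Proof. by exists (repr t); rewrite reprK. Qed.

(** Isomorphisms between trees with the same words come from the identity, which
reduces identities between operations on trees to computations on words. *)
Lemma uh_iso_ext t s : (forall u, uhv t u <-> uhv s u) -> uh_iso t s.
Proof.
move=> ts; exists id; split=> //; split=> [u /ts//|u v _ _ //|u /ts tu].
by exists u.
Qed.

Lemma uh_iso_trunc_compat R t s :
  uh_iso t s -> uh_iso (uh_trunc R t) (uh_trunc R s).
Proof.
move=> [phi [b p0 pp]]; have sz := uh_iso_size b p0 pp.
case: (b) => fphi iphi sphi; exists phi; split=> //; last by move=> u [/pp].
split.
- by move=> u [tu uR]; split; [exact: fphi|rewrite sz].
- by move=> u v; rewrite !inE => -[tu _] [tv _]; apply: iphi; rewrite inE.
- move=> v [sv vR]; have [u tu uv] := sphi _ sv; exists u => //.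
  by split=> //; rewrite -(sz _ tu) uv.
Qed.

Lemma trunc_pi R t : trunc R (\pi_tree t) = \pi_tree (uh_trunc R t).
Proof. by apply/pi_treeE/uh_iso_trunc_compat/repr_pi_iso. Qed.

Lemma parent_cons i u : u != [::] -> parent (i :: u) = i :: parent u.
Proof. by case: u. Qed.

Lemma uh_join_iso t t' s s' :
  uh_iso t t' -> uh_iso s s' -> uh_iso (uh_join t s) (uh_join t' s').
Proof.
move=> [f [bf f0 fp]] [g [bg g0 gp]].
have szf := uh_iso_size bf f0 fp; have szg := uh_iso_size bg g0 gp.
case: (bf) => ff jf sf; case: (bg) => fg jg sg.
exists (fun u => match u with
  | [::] => [::] | 0 :: u' => 0%N :: f u' | _ :: u' => 1%N :: g u' end).
split=> //.
- split.
  + by move=> [|[|[|k]] u] //=; [exact: ff|exact: fg].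
  + move=> [|[|[|k]] u] [|[|[|l]] v]//=; rewrite !inE//= => hu hv [e].
      by congr cons; apply: jf; rewrite ?inE.
    by congr cons; apply: jg; rewrite ?inE.
  + move=> [|[|[|k]] v]//=; first by exists [::].
      by move=> /sf[u tu <-]; exists (0%N :: u).
    by move=> /sg[u tu <-]; exists (1%N :: u).
- have nz (h : seq nat -> seq nat) (u : seq nat) :
    size (h u) = size u -> u != [::] -> h u != [::].
    by move=> hu; rewrite -!size_eq0 hu.
  move=> [|[|[|k]] u]//= tu.
    have [->|u0] := eqVneq u [::]; first by rewrite f0.
    by rewrite !parent_cons ?nz ?szf// fp.
  have [->|u0] := eqVneq u [::]; first by rewrite g0.
  by rewrite !parent_cons ?nz ?szg// gp.
Qed.

Lemma tjoin_pi t s : tjoin (\pi_tree t) (\pi_tree s) = \pi_tree (uh_join t s).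
Proof. by apply/pi_treeE/uh_join_iso; exact: repr_pi_iso. Qed.

Lemma tjoinC t s : tjoin t s = tjoin s t.
Proof.
apply/pi_treeE; exists (fun u => match u with
  | [::] => [::] | 0 :: u' => 1%N :: u' | _ :: u' => 0%N :: u' end).
split=> //.
- split.
  + by move=> [|[|[|k]] u].
  + by move=> [|[|[|k]] u] [|[|[|l]] v]//=; rewrite !inE//= => hu hv [->].
  + move=> [|[|[|k]] v]//=; first by exists [::].
      by exists (1%N :: v).
    by exists (0%N :: v).
- by move=> [|[|[|k]] [|? ?]].
Qed.

Lemma trunc_tjoin R t s :
  trunc R.+1 (tjoin t s) = tjoin (trunc R t) (trunc R s).
Proof.
have [u ->] := tree_pi t; have [v ->] := tree_pi s; rewrite tjoin_pi !trunc_pi tjoin_pi.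
apply/pi_treeE/uh_iso_ext => -[|[|[|k]] w] //=; last by split=> [] // [].
Qed.

Lemma trunc_height0 t : trunc 0 t = tleaf.
Proof.
apply/pi_treeE/uh_iso_ext => -[|k u] /=; first by split=> // _; split=> //; exact: uh_root.
by split=> // -[].
Qed.

Lemma trunc_trunc R R' t : (R <= R')%N -> trunc R (trunc R' t) = trunc R t.
Proof.
move=> RR'; have [v ->] := tree_pi t; rewrite !trunc_pi.
apply/pi_treeE/uh_iso_ext => u /=.
by split=> [[[]]|[tu uR]]; split=> //; split=> //; exact: leq_trans RR'.
Qed.

Lemma trunc_le R R' t s :
  (R <= R')%N -> trunc R' t = trunc R' s -> trunc R t = trunc R s.
Proof. by move=> le e; rewrite -(trunc_trunc t le) e trunc_trunc. Qed.

Lemma tbranchS C : tbranch C = tjoin (tbranch (fun n => C n.+1)) (C 0%N).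
Proof.
rewrite -[C 0%N](@reprK _ tree) tjoin_pi.
by apply/pi_treeE/uh_iso_ext => -[|[|[|k]] u].
Qed.

(** The part of [tbranch C] that matters up to height [R]: it ends in a leaf where
the branch would reach height [R], and only involves [C 0], ..., [C R.-1]. *)
Fixpoint fin_branch R (C : nat -> tree) : tree :=
  if R is R'.+1 then tjoin (fin_branch R' (fun n => C n.+1)) (C 0%N) else tleaf.

Lemma trunc_tbranch R C : trunc R (tbranch C) = trunc R (fin_branch R C).
Proof.
elim: R C => [|R IH] C; first by rewrite !trunc_height0.
by rewrite tbranchS /= !trunc_tjoin IH.
Qed.

(** There are countably many finite trees; the code makes events that depend on
a tree cut at height [R] into countable unions. *)
Definition trunc_code R (t : tree) : nat :=
  choice.pickle (enum_fset (fset_set (uhv (repr (trunc R t))))).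

Lemma trunc_finite R t : finite_set (uhv (repr (trunc R t))).
Proof.
have [phi [[fphi _ sphi] _ _]] : uh_iso (uh_trunc R (repr t)) (repr (trunc R t)).
  by apply/pi_treeE; rewrite reprK.
by apply: (sub_finite_set sphi); apply: finite_image; exact: finite_level.
Qed.

(** A finite tree is determined by the finite set of words of its representative. *)
Lemma trunc_codeE R t s :
  (trunc_code R t = trunc_code R s) <-> (trunc R t = trunc R s).
Proof.
split=> [/(pcan_inj choice.pickleK)/val_inj|e]; last by rewrite /trunc_code e.
move=> /(congr1 (fun x : {fset seq nat} => [set` x])).
rewrite !fset_setK; try exact: trunc_finite.
move=> e; rewrite -[LHS](@reprK _ tree) -[RHS](@reprK _ tree).
by apply/pi_treeE/uh_iso_ext => u; rewrite e.
Qed.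

(** Functions of the tree cut at height [R]. With [T := Prop] these are the unions
of cylinders of height [R]. *)
Definition trunc_measurable T R (f : tree -> T) :=
  forall t s, trunc R t = trunc R s -> f t = f s.

Section Topology.
Variable R : realType.

Lemma dloc_lt k (t s : ltree R) : dloc t s < expR (- k%:R) -> trunc k t = trunc k s.
Proof. by move=> lt; apply: contrapT => /dloc_ge; rewrite leNgt lt. Qed.

Lemma trunc_dloc k (t s : ltree R) : trunc k t = trunc k s -> dloc t s <= expR (- k%:R).
Proof.
move=> ts; apply: dloc_le => j; rewrite leqNgt => tsj; apply/negP => jk.
by apply: tsj; exact: trunc_le (ltnW jk) ts.
Qed.

(** A cylinder of height [k] contains the ball of radius [exp (- k)] around each of
its points. *)
Lemma trunc_open k (A : set (ltree R)) :
  trunc_measurable k A -> open A.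
Proof.
move=> Ak; rewrite openE => t At; apply/nbhs_ballP; exists (expR (- k%:R)) => /=.
  exact: expR_gt0.
by move=> s /dloc_lt ts /=; rewrite -(Ak _ _ ts).
Qed.

Lemma nbhs_trunc (A : set (ltree R)) (t : ltree R) : nbhs t A ->
  exists k, forall s : ltree R, trunc k t = trunc k s -> A s.
Proof.
move=> /nbhs_ballP[e /= e0 eA].
have [k ke] : exists k, expR (- k%:R) < e :> R.
  have : expR (- k%:R) @[k --> \oo] --> (0 : R).
    have -> : (fun k => expR (- k%:R)) = (fun k => expR (-1) ^+ k) :> (nat -> R).
      by apply/funext => k; rewrite -expRM_natl mulrN1.
    apply: cvg_expr; rewrite ger0_norm ?expR_ge0// -expR0 ltr_expR; lra.
  move/cvgrPdist_lt => /(_ _ e0)[k _ kP]; exists k.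
  by have := kP k (leqnn k); rewrite /= sub0r normrN ger0_norm ?expR_ge0.
by exists k => s ts; apply: eA; exact: le_lt_trans (trunc_dloc ts) ke.
Qed.

End Topology.

End CutTrees.

(** * The splitting recursion *)

Section SplitLaw.
Variable R : realType.

(** The probability that the part without the root has [k] vertices after a
uniform edge is removed from a recursive tree with [n] vertices. *)
Definition split_weight n k : R := n%:R / (n.-1 * (k * k.+1))%:R.

(** A finitely supported law, as a list of weighted trees. The first argument is
fuel; the last factor [y] is the part with the root. *)
Fixpoint split_law m n : seq (R * tree) :=
  if m is m'.+1 then
    if (n <= 1)%N then [:: (1, tleaf)] else
    flatten [seq [seq (split_weight n k * x.1 * y.1, tjoin y.2 x.2) |
      x <- split_law m' k, y <- split_law m' (n - k)%N] | k <- index_iota 1 n]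
  else [:: (1, tleaf)].

Definition split_expect n (f : tree -> R) : R :=
  \sum_(x <- split_law n n) x.1 * f x.2.

Lemma split_law_fuel m m' n : (n <= m)%N -> (n <= m')%N ->
  split_law m n = split_law m' n.
Proof.
elim: m m' n => [|m IH] [|m'] n /=; rewrite ?leqn0.
- by [].
- by move=> /eqP->.
- by move=> _ /eqP->.
- move=> nm nm'; case: ifP => // n1; congr flatten; apply/eq_in_map => k.
  rewrite mem_index_iota => /andP[k0 kn].
  have -> : split_law m k = split_law m' k by apply: IH; lia.
  by have -> : split_law m (n - k)%N = split_law m' (n - k)%N by apply: IH; lia.
Qed.

Lemma split_expect1 f : split_expect 1 f = f tleaf.
Proof. by rewrite /split_expect/= big_seq1 mul1r. Qed.

Lemma split_expectS n f : (1 < n)%N -> split_expect n f =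
  \sum_(1 <= k < n) split_weight n k *
    split_expect k (fun s => split_expect (n - k) (fun t => f (tjoin t s))).
Proof.
case: n => // n n1; rewrite /split_expect [split_law _ _]/= leqNgt n1/=.
rewrite big_flatten/= big_map big_seq [RHS]big_seq; apply: eq_bigr => k.
rewrite mem_index_iota => /andP[k0 kn].
rewrite big_flatten big_map mulr_sumr (@split_law_fuel n k k) //.
rewrite (@split_law_fuel n (n.+1 - k) (n.+1 - k)) //; last lia.
apply: eq_bigr => x _; rewrite big_map !mulr_sumr; apply: eq_bigr => y _ /=; ring.
Qed.

Lemma split_weight_ge0 n k : 0 <= split_weight n k.
Proof. by rewrite divr_ge0. Qed.

Lemma split_law_ge0 m n x : x \in split_law m n -> 0 <= x.1.
Proof.
elim: m n x => [|m IH] n x /=; first by rewrite inE => /eqP->.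
case: ifP => _; first by rewrite inE => /eqP->.
move=> /flattenP[s /mapP[k _ ->]] /allpairsP[[y z] /= [yin zin ->]] /=.
by rewrite !mulr_ge0 ?split_weight_ge0 ?(IH _ _ yin) ?(IH _ _ zin).
Qed.

Lemma sum_inv_succ a b : (0 < a <= b)%N ->
  \sum_(a <= k < b) (k * k.+1)%:R^-1 = a%:R^-1 - b%:R^-1 :> R.
Proof.
case/andP=> a0 ab.
rewrite (@telescope_sumr_eq _ a b (fun k => - k%:R^-1)) //.
  by rewrite opprK addrC.
move=> k /andP[ak _]; have k0 : (k%:R != 0 :> R) by rewrite pnatr_eq0; lia.
have k1 : ((k.+1)%:R != 0 :> R) by rewrite pnatr_eq0.
by rewrite natrM; move: k1; rewrite -natr1 => k1; field; apply/andP.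
Qed.

(** The terms [1 / (k * (k + 1))] telescope to [1 - 1 / n]. *)
Lemma split_weight_sum n : (1 < n)%N -> \sum_(1 <= k < n) split_weight n k = 1.
Proof.
move=> n1; have n0 : (n%:R != 0 :> R) by rewrite pnatr_eq0; lia.
have m0 : (n.-1%:R != 0 :> R) by rewrite pnatr_eq0; lia.
under eq_bigr do rewrite /split_weight natrM invfM mulrA.
rewrite -mulr_sumr sum_inv_succ; last lia.
move: n0 m0; rewrite -[in n%:R](@prednK n); last lia.
by rewrite -natr1 => n0 m0; field; apply/andP.
Qed.

Lemma split_expect_cst n c : split_expect n (fun=> c) = c.
Proof.
elim/ltn_ind: n => -[|[|n]] IH; rewrite ?split_expect1//.
  by rewrite /split_expect/= big_seq1 mul1r.
rewrite split_expectS// -[RHS]mul1r -(@split_weight_sum n.+2)// mulr_suml.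
rewrite big_seq [RHS]big_seq; apply: eq_bigr => k; rewrite mem_index_iota => /andP[k0 kn].
congr (_ * _); rewrite -[RHS](IH k)//; congr split_expect; apply/funext => s.
by apply: IH; lia.
Qed.

Lemma split_expect_le n f g : (forall t, f t <= g t) ->
  split_expect n f <= split_expect n g.
Proof.
move=> fg; rewrite /split_expect big_seq [leRHS]big_seq; apply: ler_sum => x.
by move=> /split_law_ge0 x0; exact: ler_wpM2l.
Qed.

Lemma split_expect_bound n M f : (forall t, 0 <= f t <= M) -> 0 <= split_expect n f <= M.
Proof.
move=> fM; apply/andP; split.
  by rewrite -[leLHS](split_expect_cst n); apply: split_expect_le => t; case/andP: (fM t).
by rewrite -[leRHS](split_expect_cst n); apply: split_expect_le => t; case/andP: (fM t).
Qed.

End SplitLaw.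

Section CutLinear.
Variables (R : realType) (V : finType).
Implicit Type G : lgraph V.

Lemma cut_expect_sum m G (I : Type) (s : seq I) (c : I -> R) (F : I -> tree -> R) :
  cut_expect_rec m G (fun t => \sum_(j <- s) c j * F j t) =
  \sum_(j <- s) c j * cut_expect_rec m G (F j).
Proof.
elim: m G F => [//|m IH] G F /=; case: ifP => // _.
under eq_bigr => e _.
  under [X in cut_expect_rec m _ X]funext => t do rewrite IH.
  rewrite IH; over.
rewrite exchange_big/= mulr_suml; apply: eq_bigr => j _.
by rewrite -mulr_sumr mulrA.
Qed.

Lemma cut_expectZ m G c (F : tree -> R) :
  cut_expect_rec m G (fun t => c * F t) = c * cut_expect_rec m G F.
Proof.
have := @cut_expect_sum m G unit [:: tt] (fun=> c) (fun=> F).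
by rewrite big_seq1 => <-; congr cut_expect_rec; apply/funext => t; rewrite big_seq1.
Qed.

Lemma cut_expect_sum_in m G (I : finType) (P : pred I) (F : I -> tree -> R) :
  cut_expect_rec m G (fun t => \sum_(j | P j) F j t) =
  \sum_(j | P j) cut_expect_rec m G (F j).
Proof.
have := cut_expect_sum m G (enum P) (fun=> 1) F.
rewrite big_enum/= => h; transitivity (\sum_(j | P j) 1 * cut_expect_rec m G (F j)).
  rewrite -h; congr cut_expect_rec; apply/funext => t; rewrite big_enum/=.
  by apply: eq_bigr => j _; rewrite mul1r.
by apply: eq_bigr => j _; rewrite mul1r.
Qed.

(** Both sides are finite weighted sums. The swap is needed because the order of
the two [cut_parts] depends on an enumeration of the vertex sets. *)
Lemma cut_expect_swap m m' G G' (f : tree -> tree -> R) :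
  cut_expect_rec m G (fun t => cut_expect_rec m' G' (f t)) =
  cut_expect_rec m' G' (fun s => cut_expect_rec m G (f^~ s)).
Proof.
elim: m' G' f => [//|m' IH] G' f /=; case: ifP => // _.
under [X in cut_expect_rec m _ X]funext => t do rewrite mulrC.
rewrite cut_expectZ mulrC; congr (_ / _); rewrite cut_expect_sum_in.
apply: eq_bigr => e _; rewrite IH.
by congr cut_expect_rec; apply/funext => u; rewrite IH.
Qed.

End CutLinear.

(** * Recursive trees as parent functions, and the effect of a cut *)

Section ParentMaps.
Variable n : nat.
Implicit Types (A B D : {set 'I_n}) (p q : {ffun 'I_n -> 'I_n}) (r i j : 'I_n).

(** Recursive trees on the label set [A] with root [r]: each label of [A] except
[r] is sent to its parent, and everything else is fixed, so that a tree has
only one encoding. *)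
Definition parent_maps r A : {set {ffun 'I_n -> 'I_n}} :=
  [set p : {ffun 'I_n -> 'I_n} | [forall i,
    if (i \in A) && (i != r) then (p i \in A) && (p i < i)%N else p i == i]].

Lemma parent_mapsP r A p : reflect
  ((forall i, i \in A -> i != r -> p i \in A /\ (p i < i)%N) /\
   (forall i, (i \notin A) || (i == r) -> p i = i))
  (p \in parent_maps r A).
Proof.
rewrite inE; apply: (iffP forallP) => [h|[h1 h2] i].
  split=> i; first by move=> iA ir; have := h i; rewrite iA ir => /andP.
  by have := h i; case: (i \in A) => //=; case: eqVneq => // _ /eqP.
have [/andP[iA ir]|] := ifPn; first by have [-> ->] := h1 i iA ir.
by rewrite negb_and negbK => /h2 ->.
Qed.

Lemma parent_maps_le r A p i : p \in parent_maps r A -> (p i <= i)%N.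
Proof.
case/parent_mapsP => h1 h2; have [/andP[iA ir]|] := boolP ((i \in A) && (i != r)).
  by apply: ltnW; have [] := h1 i iA ir.
by rewrite negb_and negbK => /h2 ->.
Qed.

Definition parent_edges p : {set {set 'I_n}} :=
  finset.imset (fun i => finset.setU (finset.set1 i) (finset.set1 (p i))) (mem [pred i | p i != i]).

Definition parent_graph A p : lgraph 'I_n := (A, parent_edges p).

Lemma parent_edgesP p e : reflect (exists2 i, p i != i & e = [set i; p i]%SET) (e \in parent_edges p).
Proof. by apply: (iffP imsetP) => -[i ip ->]; exists i => //; rewrite ?inE in ip *. Qed.

Lemma set2_eq_cases (x y i k : 'I_n) : x != y -> [set x; y]%SET = [set i; k]%SET ->
  (x = i /\ y = k) \/ (x = k /\ y = i).
Proof.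
move=> xy e.
have : x \in [set i; k]%SET by rewrite -e !inE eqxx.
have : y \in [set i; k]%SET by rewrite -e !inE eqxx orbT.
rewrite !inE => /orP[/eqP yi|/eqP yk] /orP[/eqP xi|/eqP xk]; auto;
  by rewrite ?yi ?yk ?xi ?xk eqxx in xy.
Qed.

Lemma parent_adjE p x y : adj (parent_edges p) x y =
  (x != y) && ((p x == y) || (p y == x)).
Proof.
rewrite /adj; case: (eqVneq x y) => //= xy; apply/idP/idP.
  by move=> /parent_edgesP[i ip /(set2_eq_cases xy)[[-> ->]|[-> ->]]]; rewrite eqxx ?orbT.
move=> /orP[/eqP e|/eqP e]; apply/parent_edgesP.
  by exists x; rewrite ?e // eq_sym.
by exists y; rewrite ?e // finset.setUC.
Qed.

Lemma adj_sym (E : {set {set 'I_n}}) : symmetric (adj E).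
Proof. by move=> x y; rewrite /adj eq_sym finset.setUC. Qed.

(** Parents are smaller, so that following them ends at the root. *)
Lemma parent_connect r A p x : p \in parent_maps r A -> x \in A ->
  connect (adj (parent_edges p)) x r.
Proof.
move=> pA; have [h1 h2] := parent_mapsP _ _ _ pA.
have [m] := ubnP (x : nat); elim: m x => // m IH x xm xA.
have [->|xr] := eqVneq x r; first exact: connect0.
have [pxA px] := h1 x xA xr.
have pxm : (p x < m)%N by move: px xm; lia.
apply: connect_trans (IH _ pxm pxA).
apply: connect1; rewrite parent_adjE eqxx andbT.
by apply: contraTN px => /eqP <-; rewrite ltnn.
Qed.

(** What is needed of the set [D] of descendants of [i] to remove the edge between
[i] and its parent: it contains [i] but not [p i], and no other edge leaves it. *)
Definition cut_block A r p i D :=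
  [/\ D \subset A, i \in D, r \notin D, p i \notin D &
      forall j, j \in A -> j != i -> (p j \in D) = (j \in D)].

Definition restrict_parent p D : {ffun 'I_n -> 'I_n} :=
  [ffun j => if (j \in D) && (p j \in D) then p j else j].

Definition descendants p i : {set 'I_n} :=
  [set j : 'I_n | connect (frel p) j i]%SET.

Lemma descendants_block r A p i : p \in parent_maps r A -> i \in A -> i != r ->
  cut_block A r p i (descendants p i).
Proof.
move=> pA iA ir; have [h1 h2] := parent_mapsP _ _ _ pA.
have stay (x : 'I_n) : p x = x -> connect (frel p) x i -> x = i.
  move=> px /connectP[s]; elim: s => [_ ->//|y s IH] /= /andP[/eqP <-].
  by rewrite px.
have dec x y : connect (frel p) x y -> (y <= x)%N.
  move=> /connectP[s]; elim: s x => [x _ ->//|z s IH] x /= /andP[/eqP pz ps] l.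
  by apply: leq_trans (IH z ps l) _; rewrite -pz; exact: parent_maps_le pA.
split.
- apply/fintype.subsetP => j; rewrite inE => ji; apply: contraT => jA.
  by rewrite -(stay j _ ji) ?h2 ?jA// in iA; rewrite iA in jA.
- by rewrite inE connect0.
- rewrite inE; apply/negP => ri; move/eqP: ir; apply.
  by rewrite (stay r) // h2 // eqxx orbT.
- rewrite inE; apply/negP => /dec; have [_] := h1 i iA ir; lia.
- move=> j jA ji; rewrite !inE; apply/idP/idP => [pj|].
    by apply: connect_trans pj; apply: connect1; rewrite /= eqxx.
  move=> /connectP[[|y s] /=]; first by move=> _ e; rewrite e eqxx in ji.
  by move=> /andP[/eqP <- ps] l; apply/connectP; exists s.
Qed.

(** A label of [D] other than [i] has a smaller parent in [D], so that its
ancestors reach [i] without leaving [D]; outside [D], ancestors stay outside. *)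
Lemma block_descendants r A p i D : p \in parent_maps r A ->
  cut_block A r p i D -> descendants p i = D.
Proof.
move=> pA [DA iD rD piD Dp]; have [h1 h2] := parent_mapsP _ _ _ pA.
apply/finset.setP => j; rewrite inE.
have [m] := ubnP (j : nat); elim: m j => // m IH j jm.
have [->|ji] := eqVneq j i; first by rewrite connect0 iD.
have [jA|jA] := boolP (j \in A); last first.
  have -> : (j \in D) = false by apply: contraNF jA => /(fintype.subsetP DA).
  apply/negP => /connectP[s]; elim: s => [_ e|y s IHs /=].
    by rewrite e eqxx in ji.
  by rewrite {1}h2 ?jA// => /andP[/eqP <-].
have [jr|jr] := eqVneq j r.
  rewrite jr (negbTE rD); apply/negP => /connectP[s].
  elim: s => [_ e|y s IHs /=]; first by rewrite jr e eqxx in ji.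
  by rewrite {1}h2 ?eqxx ?orbT// => /andP[/eqP <-].
have [_ pj] := h1 j jA jr.
rewrite -Dp// -IH; last by move: pj jm; lia.
apply/idP/idP => [/connectP[[|y s] /=]|pji].
- by move=> _ e; rewrite e eqxx in ji.
- by move=> /andP[/eqP <- ps] l; apply/connectP; exists s.
- by apply: connect_trans pji; apply: connect1; rewrite /= eqxx.
Qed.

Section Block.
Variables (r i : 'I_n) (A D : {set 'I_n}) (p : {ffun 'I_n -> 'I_n}).
Hypotheses (pA : p \in parent_maps r A) (iA : i \in A) (ir : i != r)
  (b : cut_block A r p i D).

Lemma block_restrict_in : restrict_parent p D \in parent_maps i D.
Proof.
have [h1 h2] := parent_mapsP _ _ _ pA; have [DA iD rD piD Dp] := b.
apply/parent_mapsP; split=> j.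
  move=> jD ji; have jA := fintype.subsetP DA _ jD.
  have pjD : p j \in D by rewrite Dp.
  rewrite ffunE jD pjD/=; split=> //; apply: (h1 j jA _).2.
  by apply: contraNneq rD => <-.
rewrite ffunE; case: (boolP (j \in D)) => //= _ /eqP ->.
by rewrite (negbTE piD).
Qed.

Lemma block_restrict_out : restrict_parent p (A :\: D)%SET \in parent_maps r (A :\: D)%SET.
Proof.
have [h1 h2] := parent_mapsP _ _ _ pA; have [DA iD rD piD Dp] := b.
apply/parent_mapsP; split=> j.
  rewrite !inE => /andP[jD jA] jr; rewrite ffunE !inE jD jA/=.
  have ji : j != i by apply: contraNneq jD => ->.
  have [pjA pj] := h1 j jA jr.
  by rewrite pjA Dp// jD/= pjA Dp// jD.
rewrite ffunE; case: ifP => // /andP[jAD _]; rewrite jAD/= => jr.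
by apply: h2; rewrite jr orbT.
Qed.

Lemma cut_edge_eq j : p j != j -> ([set j; p j] == [set i; p i])%SET = (j == i).
Proof.
have pi : p i != i by have [_ iD _ piD _] := b; apply: contraNneq piD => ->.
move=> pj; apply/eqP/eqP => [|-> //].
rewrite eq_sym in pj; move=> /(set2_eq_cases pj)[[//]|[e1 e2]].
have := parent_maps_le j pA; have := parent_maps_le i pA.
rewrite e2 -e1 => ji ij; apply/val_inj/eqP.
by rewrite eqn_leq ij ji.
Qed.

Let e := [set i; p i]%SET.
Let G' : lgraph 'I_n := (A, parent_edges p :\ e)%SET.

Lemma block_induced D' : ~~ (e \subset D') ->
  induced_subgraph G' D' = parent_graph D' (restrict_parent p D').
Proof.
move=> eD'; rewrite /induced_subgraph /parent_graph; congr pair.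
apply/finset.setP => f; rewrite inE !inE; apply/idP/parent_edgesP.
  case/andP => /andP[fe /parent_edgesP[j pj fj]] fD; exists j; rewrite ffunE.
    by move: fD; rewrite fj finset.subUset !finset.sub1set => ->.
  by move: fD; rewrite fj finset.subUset !finset.sub1set => ->.
case=> j; rewrite ffunE; case: ifP => [/andP[jD pjD] pj ->|]; last by rewrite eqxx.
rewrite finset.subUset !finset.sub1set jD pjD !andbT cut_edge_eq//; apply/andP; split.
  by apply: contraNneq eD' => ji; rewrite /e -ji finset.subUset !finset.sub1set jD.
by apply/parent_edgesP; exists j.
Qed.

Lemma sub_in_block : ~~ (e \subset D) /\ ~~ (e \subset (A :\: D))%SET.
Proof.
have [DA iD rD piD Dp] := b.
by rewrite /e !finset.subUset !finset.sub1set (negbTE piD) andbF !inE iD.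
Qed.

Lemma restrict_connect D' s x : ~~ (e \subset D') ->
  restrict_parent p D' \in parent_maps s D' -> x \in D' ->
  connect (adj (parent_edges p :\ e)%SET) x s.
Proof.
move=> eD' pD' xD'; apply: connect_sub (parent_connect pD' xD').
move=> u v; have := block_induced eD'; rewrite /induced_subgraph/parent_graph.
move=> /(congr1 snd)/= <- /andP[uv]; rewrite inE => /andP[h _].
by apply: connect1; rewrite /adj uv.
Qed.

Lemma block_closed x y : x \in A -> y \in A ->
  connect (adj (parent_edges p :\ e)%SET) x y -> (x \in D) = (y \in D).
Proof.
have [h1 h2] := parent_mapsP _ _ _ pA; have [DA iD rD piD Dp] := b.
have stepp j : p j != j -> j != i -> (p j \in D) = (j \in D).
  move=> pj ji; apply: Dp => //; apply: contraNT pj => jA.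
  by rewrite h2// jA.
move=> xA yA xy; apply: (@closed_connect _ _ (mem D)) xy => u v.
rewrite /adj => /andP[uv]; rewrite finset.in_setD1 => /andP[ne].
move=> /parent_edgesP[j pj uvj]; move: ne; rewrite uvj cut_edge_eq// => ji.
by have [[-> ->]|[-> ->]] := set2_eq_cases uv uvj; [exact/esym/stepp|exact: stepp].
Qed.

(** The two parts are connected as trees of their own, and no edge that remains
leaves [D]. *)
Lemma block_component x : x \in A ->
  component G' x = if x \in D then D else (A :\: D)%SET.
Proof.
move=> xA; have [DA iD rD piD Dp] := b; have [eD eAD] := sub_in_block.
apply/finset.setP => y; rewrite inE /=.
have cs : connect_sym (adj (parent_edges p :\ e)%SET) by apply/sym_connect_sym/adj_sym.
case: ifPn => xD.
  apply/andP/idP => [[yA /block_closed <-//]|yD].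
  split; first exact: (fintype.subsetP DA).
  apply: connect_trans (restrict_connect eD block_restrict_in xD) _.
  by rewrite cs; exact: restrict_connect eD block_restrict_in yD.
rewrite inE; apply/andP/andP => [[yA /block_closed <-//]|[yD yA]].
split=> //.
apply: connect_trans (restrict_connect eAD block_restrict_out _) _; rewrite ?inE ?xD//.
by rewrite cs; apply: restrict_connect eAD block_restrict_out _; rewrite inE yD.
Qed.

Lemma block_cut_parts : r \in A ->
  let G1 := parent_graph D (restrict_parent p D) in
  let G2 := parent_graph (A :\: D)%SET (restrict_parent p (A :\: D)%SET) in
  cut_parts (parent_graph A p) e = (G1, G2) \/
  cut_parts (parent_graph A p) e = (G2, G1).
Proof.
move=> rA G1 G2; have [DA iD rD piD Dp] := b; have [eD eAD] := sub_in_block.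
have DAD : D != (A :\: D)%SET.
  by apply/eqP => /finset.setP/(_ i); rewrite !inE iD.
have comps : [set component G' x | x in A]%SET = [set D; (A :\: D)]%SET.
  apply/finset.setP => S; rewrite !inE; apply/imsetP/orP.
    by case=> x xA ->; rewrite block_component//; case: ifP => _; rewrite eqxx; auto.
  case=> /eqP ->; [exists i => //|exists r => //]; rewrite block_component// ?iD//.
  by rewrite (negbTE rD).
rewrite /cut_parts -/G' /= comps.
have : perm_eq (enum [set D; (A :\: D)]%SET) [:: D; (A :\: D)%SET].
  apply: uniq_perm; rewrite ?enum_uniq//=; first by rewrite inE DAD.
  by move=> S; rewrite mem_enum !inE.
have := perm_size; move=> /(_ _ _ _); set s := enum _ => sz ps.
have := sz _ _ _ ps; have := perm_uniq ps; have := perm_mem ps.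
case: s ps {sz} => [|a [|c [|? ?]]]//= ps mm uu _.
have /orP[/eqP aD|/eqP aD] : (a == D) || (a == A :\: D)%SET.
  by have := mm a; rewrite !inE eqxx => <-.
- left; have /orP[/eqP cD|/eqP cD] : (c == D) || (c == A :\: D)%SET.
    by have := mm c; rewrite !inE eqxx orbT => <-.
  + by move: uu; rewrite aD cD !inE eqxx DAD.
  + by rewrite aD cD !block_induced.
- right; have /orP[/eqP cD|/eqP cD] : (c == D) || (c == A :\: D)%SET.
    by have := mm c; rewrite !inE eqxx orbT => <-.
  + by rewrite aD cD !block_induced.
  + by move: uu; rewrite aD cD !inE eqxx DAD.
Qed.

End Block.

Lemma parent_edge_inj r A p i j : p \in parent_maps r A -> p i != i -> p j != j ->
  [set i; p i]%SET = [set j; p j]%SET -> i = j.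
Proof.
move=> pA pi pj; rewrite eq_sym in pi; move=> /(set2_eq_cases pi)[[//]|[e1 e2]].
have := parent_maps_le j pA; have := parent_maps_le i pA.
rewrite e2 -e1 => ji ij; apply/val_inj/eqP.
by rewrite eqn_leq ij ji.
Qed.

Lemma parent_nonfix r A p i : p \in parent_maps r A ->
  (p i != i) = (i \in A) && (i != r).
Proof.
move=> pA; have [h1 h2] := parent_mapsP _ _ _ pA; have [/andP[iA ir]|] := boolP ((i \in A) && (i != r)).
  by have [_ pi] := h1 i iA ir; apply: contraTneq pi => ->; rewrite ltnn.
by rewrite negb_and negbK => /h2 ->; rewrite eqxx.
Qed.

(** Each edge is counted at its larger endpoint. *)
Lemma sum_parent_edges (T : nmodType) r A p (H : {set 'I_n} -> T) : p \in parent_maps r A ->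
  \sum_(e in parent_edges p) H e =
  \sum_(i | (i \in A) && (i != r)) H [set i; p i]%SET.
Proof.
move=> pA; rewrite big_imset/=; last first.
  by move=> i j; rewrite !inE => pi pj; exact: parent_edge_inj pA pi pj.
by apply: eq_bigl => i; rewrite inE (parent_nonfix _ pA).
Qed.

Lemma card_parent_edges r A p : p \in parent_maps r A -> r \in A ->
  #|parent_edges p| = #|A|.-1.
Proof.
move=> pA rA; rewrite -sum1_card (sum_parent_edges _ pA) sum1_card.
rewrite (cardD1 r A) rA/=; apply: eq_card => i.
by rewrite !inE andbC.
Qed.

Lemma cut_step (R : realType) m r A p (f : tree -> R) :
  p \in parent_maps r A -> r \in A -> (1 < #|A|)%N ->
  cut_expect_rec m.+1 (parent_graph A p) f =
  (\sum_(i | (i \in A) && (i != r)) let D := descendants p i in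
    cut_expect_rec m (parent_graph D (restrict_parent p D)) (fun s =>
      cut_expect_rec m (parent_graph (A :\: D) (restrict_parent p (A :\: D)))%SET
        (fun t => f (tjoin t s)))) / (#|A|.-1)%:R.
Proof.
move=> pA rA A1.
have -> : cut_expect_rec m.+1 (parent_graph A p) f = (\sum_(e in parent_edges p)
    cut_expect_rec m (cut_parts (parent_graph A p) e).1 (fun t =>
      cut_expect_rec m (cut_parts (parent_graph A p) e).2 (fun s => f (tjoin t s))))
    / #|parent_edges p|%:R.
  by rewrite [LHS]/= leqNgt A1.
rewrite (card_parent_edges pA rA).
rewrite (sum_parent_edges _ pA); congr (_ / _); apply: eq_bigr => i /andP[iA ir].
have b := descendants_block pA iA ir.
have [->|->] /= := block_cut_parts pA iA b rA; last by rewrite cut_expect_swap.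
congr cut_expect_rec; apply/funext => t; congr cut_expect_rec; apply/funext => s.
by rewrite tjoinC.
Qed.

End ParentMaps.

(** * Counting the cuts with given parts *)

Section Splitting.
Variable n : nat.
Implicit Types (A B D : {set 'I_n}) (p q : {ffun 'I_n -> 'I_n}) (r i j : 'I_n).

(** The default [d] only serves the empty set. *)
Definition least d B : 'I_n :=
  odflt d [pick i | (i \in B) && [forall j in B, (i <= j)%N]].

Lemma least_eq d B i : i \in B -> (forall j, j \in B -> (i <= j)%N) -> least d B = i.
Proof.
move=> iB iP; rewrite /least; case: pickP => [k /andP[kB /forall_inP kP]|/(_ i)] /=.
  by apply/val_inj/eqP; rewrite eqn_leq kP// iP.
by rewrite iB/= => /forall_inP; case.
Qed.

Lemma leastP d B : B != finset.set0 -> least d B \in B /\ forall j, j \in B -> (least d B <= j)%N.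
Proof.
move=> /finset.set0Pn[i iB]; pose k := [arg min_(j < i in B) (j : nat)].
have [kB kP] : k \in B /\ forall j, j \in B -> (k <= j)%N by rewrite /k; case: arg_minnP.
by rewrite (least_eq d kB kP).
Qed.

(** The tree obtained from a tree [p1] on [B] with root [i] and a tree [p2] by
adding an edge between [i] and [a]. *)
Definition glue a i B p1 p2 : {ffun 'I_n -> 'I_n} :=
  [ffun j => if j == i then a else if j \in B then p1 j else p2 j].

(** The pairs formed by the labels of the part without the root and the upper
endpoint of the removed edge. *)
Definition pointed A (x : {set 'I_n} * 'I_n) : bool :=
  [&& x.1 \subset A, x.1 != finset.set0, x.2 \in A & [forall j in x.1, (x.2 < j)%N]].

(** Cutting the edge above [i] and gluing are inverse to each other: [i] is
recovered as the least label of its descendants. *)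
Lemma sum_cut_pairs (T : nmodType) r A (F : {set 'I_n} -> {ffun 'I_n -> 'I_n} -> {ffun 'I_n -> 'I_n} -> T) :
  r \in A -> (forall j, j \in A -> (r <= j)%N) ->
  \sum_(p in parent_maps r A) \sum_(i | (i \in A) && (i != r))
    (let D := descendants p i in F D (restrict_parent p D) (restrict_parent p (A :\: D)%SET)) =
  \sum_(x | pointed A x)
    \sum_(p1 in parent_maps (least r x.1) x.1)
      \sum_(p2 in parent_maps r (A :\: x.1)%SET) F x.1 p1 p2.
Proof.
move=> rA rmin.
under [RHS]eq_bigr do rewrite pair_big.
rewrite !pair_big_dep /=.
pose h (y : ({set 'I_n} * 'I_n) * ({ffun 'I_n -> 'I_n} * {ffun 'I_n -> 'I_n})) :=
  let i := least r y.1.1 in (glue y.1.2 i y.1.1 y.2.1 y.2.2, i).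
pose h' (x : {ffun 'I_n -> 'I_n} * 'I_n) := let D := descendants x.1 x.2 in
  ((D, x.1 x.2), (restrict_parent x.1 D, restrict_parent x.1 (A :\: D)%SET)).
pose P (x : {ffun 'I_n -> 'I_n} * 'I_n) := (x.1 \in parent_maps r A) && ((x.2 \in A) && (x.2 != r)).
pose Q (y : ({set 'I_n} * 'I_n) * ({ffun 'I_n -> 'I_n} * {ffun 'I_n -> 'I_n})) :=
  pointed A y.1 && ((y.2.1 \in parent_maps (least r y.1.1) y.1.1) &&
    (y.2.2 \in parent_maps r (A :\: y.1.1)%SET)).
have cut_then_glue x : P x -> h (h' x) = x /\ Q (h' x).
  case: x => p i /andP[/= pA /andP[iA ir]].
  have [h1 h2] := parent_mapsP _ _ _ pA.
  have b := descendants_block pA iA ir; have [DA iD rD piD Dp] := b.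
  have [piA pi] := h1 i iA ir.
  have lD : least r (descendants p i) = i.
    apply: least_eq => // j jD; have jA := fintype.subsetP DA _ jD.
    have [m] := ubnP (j : nat); elim: m j jD jA => // m IH j jD jA jm.
    have [->//|ji] := eqVneq j i.
    have jr : j != r by apply: contraNneq rD => <-.
    have [pjA pj] := h1 j jA jr; have pjD : p j \in descendants p i by rewrite Dp.
    apply: leq_trans (ltnW pj); apply: IH => //; exact: leq_trans pj jm.
  split.
    rewrite /h /h' /= lD; congr pair; apply/ffunP => j; rewrite !ffunE.
    case: eqVneq => [->//|ji]; case: ifP => [jD|/negbT jD].
      by rewrite Dp ?jD// (fintype.subsetP DA _ jD).
    rewrite !finset.in_setD jD/=; have [jA|jA] := boolP (j \in A); last by rewrite h2// jA.
    have [->|jr] := eqVneq j r; first by rewrite h2 ?eqxx ?orbT//; case: ifP.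
    by rewrite Dp// jD/=; have [-> _] := h1 j jA jr.
  rewrite /Q /h' /pointed /= lD (block_restrict_in pA b) (block_restrict_out pA b) DA piA/= !andbT.
  apply/andP; split; first by apply/finset.set0Pn; exists i.
  apply/forall_inP => j jD; apply: leq_trans pi _; rewrite -lD.
  by have [] := leastP r (B := descendants p i); [apply/finset.set0Pn; exists i|move=> _; exact].
have glue_then_cut y : Q y -> P (h y) /\ h' (h y) = y.
  case: y => [[B a] [p1 p2]] /andP[/= /and4P[/= BA B0 aA /forall_inP aB] /andP[p1B p2B]].
  have [iB imin] := leastP r B0; set i := least r B in iB imin p1B *.
  have [h1 h2] := parent_mapsP _ _ _ p1B; have [k1 k2] := parent_mapsP _ _ _ p2B.
  have iA := fintype.subsetP BA _ iB.
  have ai := aB i iB; have ra := rmin a aA.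
  have ir : i != r by apply: contraTneq ai => ->; rewrite -leqNgt.
  have rB : r \notin B by apply/negP => /aB; rewrite ltnNge ra.
  have aNB : a \notin B by apply/negP => /aB; rewrite ltnn.
  set p := glue a i B p1 p2.
  have pi : p i = a by rewrite ffunE eqxx.
  have pB j : j \in B -> j != i -> p j = p1 j /\ p j \in B.
    by move=> jB ji; rewrite ffunE (negbTE ji) jB; split=> //; have [] := h1 j jB ji.
  have pNB j : j \notin B -> p j = p2 j.
    move=> jB; rewrite ffunE (negbTE jB) ifF//; apply: contraNF jB.
    by move=> /eqP->.
  have pA : p \in parent_maps r A.
    apply/parent_mapsP; split=> j.
      move=> jA jr; have [->|ji] := eqVneq j i; first by rewrite pi.
      have [jB|jB] := boolP (j \in B).
        have [-> _] := pB j jB ji; have [p1jB ->] := h1 j jB ji.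
        by split=> //; exact: fintype.subsetP BA _ p1jB.
      rewrite pNB//; have [|p2j ->] := k1 j _ jr; first by rewrite inE jB.
      by move: p2j; rewrite inE => /andP[].
    move=> jAr; rewrite pNB; last first.
      by case/orP: jAr => [|/eqP->//]; apply: contra => /(fintype.subsetP BA).
    apply: k2; case/orP: jAr => [jA|->]; last by rewrite orbT.
    by rewrite inE (negbTE jA) andbF.
  have b : cut_block A r p i B.
    split=> //; first by rewrite pi.
    move=> j jA ji; have [jB|jB] := boolP (j \in B); first by have [_ ->] := pB j jB ji.
    rewrite pNB//; have [->|jr] := eqVneq j r; first by rewrite k2 ?eqxx ?orbT// (negbTE rB).
    have [|p2j _] := k1 j _ jr; first by rewrite inE jB.
    by move: p2j; rewrite inE => /andP[/negbTE ->].
  split; first by rewrite /P /h /= -/i -/p pA iA ir.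
  rewrite /h /h' /= -/i -/p (block_descendants pA b) pi; congr (_, (_, _)).
    apply/ffunP => j; rewrite ffunE; case: ifP => [/andP[jB pjB]|].
      have ji : j != i by apply: contraTneq pjB => ->; rewrite pi.
      by have [-> _] := pB j jB ji.
    have [jB /= pjB|jB _] := boolP (j \in B); last by rewrite h2// jB.
    have [->|ji] := eqVneq j i; first by rewrite h2// eqxx orbT.
    by have [_] := pB j jB ji; rewrite pjB.
  apply/ffunP => j; rewrite ffunE.
  have [jAB|jAB] := boolP (j \in (A :\: B)%SET); last by rewrite k2// jAB.
  have jB : j \notin B by move: jAB; rewrite inE => /andP[].
  rewrite pNB//=; case: ifP => //; have [->|jr] := eqVneq j r.
    by rewrite k2 ?eqxx ?orbT.
  by have [-> _] := k1 j jAB jr.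
rewrite (@reindex_onto _ _ _ _ _ h h' P (fun x => F _ _ _)); last by move=> x /cut_then_glue[].
apply: eq_big => [y|y /andP[Ph /eqP e]] /=.
  apply/andP/idP => [[Phy /eqP e]|Qy]; last by have [? ->] := glue_then_cut y Qy.
  by have [_] := cut_then_glue _ Phy; rewrite e.
by rewrite -[in RHS]e.
Qed.

(** [(B, a)] corresponds to the set [a |: B], in which [a] is the least element. *)
Lemma card_pointed A k : (0 < k)%N ->
  #|[set x | pointed A x && (#|x.1| == k)]%SET| = 'C(#|A|, k.+1).
Proof.
move=> k0; rewrite -cards_draws.
pose h (x : {set 'I_n} * 'I_n) := (x.2 |: x.1)%SET.
rewrite -(@card_in_imset _ _ h); last first.
  move=> [B a] [B' a']; rewrite !inE => /andP[/and4P[/= _ _ _ /forall_inP aB] _].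
  move=> /andP[/and4P[/= _ _ _ /forall_inP aB'] _]; rewrite /h/= => e.
  have aa' : a = a'.
    apply/val_inj/eqP; rewrite eqn_leq.
    have /finset.setU1P[<-|/aB'/ltnW ->] : a \in (a' |: B')%SET by rewrite -e finset.setU11.
      by rewrite leqnn.
    rewrite andbT; have /finset.setU1P[->//|/aB/ltnW//] : a' \in (a |: B)%SET.
    by rewrite e finset.setU11.
  subst a'; congr pair; rewrite -(@finset.setU1K _ a B) ?e ?finset.setU1K//.
    by apply/negP => /aB'; rewrite ltnn.
  by apply/negP => /aB; rewrite ltnn.
apply: eq_card => S; rewrite !inE; apply/imsetP/andP.
  case=> -[B a]; rewrite inE => /andP[/and4P[/= BA _ aA /forall_inP aB] /eqP Bk] ->.
  rewrite /h/= finset.subUset finset.sub1set aA BA cardsU1 Bk; split=> //.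
  by rewrite (_ : a \notin B)//; apply/negP => /aB; rewrite ltnn.
move=> [SA /eqP Sk].
have S0 : S != finset.set0 by rewrite -card_gt0 Sk.
have [i0 i0S] := finset.set0Pn _ S0.
have [aS aP] := leastP i0 S0; set a := least i0 S in aS aP.
have cS : #|(S :\ a)%SET| = k by have := cardsD1 a S; rewrite aS Sk => -[].
exists ((S :\ a)%SET, a); last by rewrite /h/= finset.setD1K.
rewrite inE /= cS eqxx andbT; apply/and4P; split=> /=.
- exact: fintype.subset_trans (finset.subsetDl _ _) SA.
- by rewrite -card_gt0 cS.
- exact: fintype.subsetP SA _ aS.
- apply/forall_inP => j; rewrite !inE => /andP[ja jS].
  by rewrite ltn_neqAle aP// andbT eq_sym.
Qed.

Lemma sum_pointed (R : realType) A (g : nat -> R) :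
  \sum_(x | pointed A x) g #|x.1| = \sum_(1 <= k < #|A|) 'C(#|A|, k.+1)%:R * g k.
Proof.
pose K := #|A|.
have H x : pointed A x -> (0 < #|x.1| < K)%N.
  case: x => B a /and4P[/= BA B0 aA /forall_inP aB]; rewrite card_gt0 B0/=.
  apply: proper_card; apply/properP; split=> //; exists a => //.
  by apply/negP => /aB; rewrite ltnn.
transitivity (\sum_(x | pointed A x) \sum_(1 <= k < K | k == #|x.1|) g k).
  by apply: eq_bigr => x /H xk; rewrite big_nat1_eq xk.
rewrite (exchange_big_dep predT)//= [RHS]big_nat_cond big_nat_cond.
apply: eq_bigr => k /andP[/andP[k0 _] _].
rewrite -(card_pointed A k0) -sum1_card natr_sum mulr_suml.
by apply: eq_big => [x|x _]; rewrite ?inE ?mul1r// eq_sym.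
Qed.

Lemma parent_maps_set1 r : parent_maps r (finset.set1 r) = finset.set1 (finfun id).
Proof.
apply/finset.setP => p; rewrite inE finset.in_set1; apply/forallP/eqP => [h|-> i].
  apply/ffunP => i; rewrite ffunE; apply/eqP; have := h i.
  by rewrite finset.in_set1; case: eqVneq.
by rewrite finset.in_set1 ffunE; case: eqVneq => //=; rewrite eqxx.
Qed.

(** Since there are [(m - 1)`!] recursive trees on [m] labels, the numerator counts the
pairs (tree, edge) on [N] labels whose part without the root has [k] labels. *)
Lemma binomial_weight (R : realType) N k : (0 < k < N)%N ->
  'C(N, k.+1)%:R * (((k.-1)`!)%:R * ((N - k).-1`!)%:R) / N.-1%:R =
  (N.-1)`!%:R * split_weight R N k.
Proof.
case: N => [|[|N]]; [by case: k|by case: k => [|[]]|].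
case: k => // k /andP[_ kN]; rewrite /split_weight /=.
have fN : (N.+2`! = 'C(N.+2, k.+2) * (k.+2`! * (N.+2 - k.+2)`!))%N by rewrite bin_fact.
have -> : (N.+2 - k.+1).-1 = (N.+2 - k.+2)%N by lia.
have e : (N.+2%:R * N.+1`!%:R = 'C(N.+2, k.+2)%:R * (k.+2%:R * k.+1%:R * k`!%:R * (N.+2 - k.+2)`!%:R) :> R).
  by rewrite -natrM -factS fN (factS k.+1) (factS k) !natrM !mulrA.
have z1 : (k.+1%:R != 0 :> R) by rewrite pnatr_eq0.
have z2 : (k.+2%:R != 0 :> R) by rewrite pnatr_eq0.
have z3 : (N.+1%:R != 0 :> R) by rewrite pnatr_eq0.
rewrite (natrM _ N.+1) (natrM _ k.+1) [RHS]mulrA [in RHS](mulrC _ N.+2%:R) e.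
move: z1 z2 z3; move: (k.+1%:R : R) (k.+2%:R : R) (N.+1%:R : R) => a b c z1 z2 z3.
by field; rewrite z1 z2 z3.
Qed.

(** The splitting property. The induction runs over all label sets, so that its
hypothesis applies to the two parts as they are. *)
Lemma sum_cut (R : realType) m r A (f : tree -> R) :
  r \in A -> (forall j, j \in A -> (r <= j)%N) -> (#|A| <= m)%N ->
  \sum_(p in parent_maps r A) cut_expect_rec m (parent_graph A p) f =
  (#|A|.-1)`!%:R * split_expect #|A| f.
Proof.
elim: m r A f => [|m IH] r A f rA rmin Am.
  by move: Am; rewrite leqn0 cards_eq0 => /eqP A0; rewrite A0 inE in rA.
have [A1|A1] := leqP #|A| 1.
  have A1' : #|A| = 1%N by apply/eqP; rewrite eqn_leq A1 card_gt0; apply/finset.set0Pn; exists r.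
  have /cards1P[x Ax] : #|A| == 1%N by rewrite A1'.
  move: rA; rewrite Ax finset.in_set1 => /eqP rx; rewrite -rx parent_maps_set1 finset.big_set1/=.
  by rewrite cards1/= mul1r split_expect1.
under eq_bigr => p pA do rewrite (cut_step m f pA rA A1).
rewrite -mulr_suml (sum_cut_pairs (fun D p1 p2 =>
  cut_expect_rec m (parent_graph D p1) (fun s =>
      cut_expect_rec m (parent_graph (A :\: D)%SET p2) (fun t => f (tjoin t s)))) rA rmin).
pose g k := (k.-1)`!%:R * ((#|A| - k).-1`!)%:R *
   split_expect k (fun s => split_expect (#|A| - k) (fun t => f (tjoin t s))) : R.
transitivity ((\sum_(x | pointed A x) g #|x.1|) / #|A|.-1%:R).
  congr (_ / _); apply: eq_bigr => -[B a] /and4P[/= BA B0 aA /forall_inP aB].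
  have [iB imin] := leastP r B0.
  have rB : r \notin B by apply/negP => /aB; rewrite ltnNge rmin.
  have cAB : #|(A :\: B)%SET| = (#|A| - #|B|)%N by rewrite cardsD (finset.setIidPr BA).
  have B0' : (0 < #|B|)%N by rewrite card_gt0.
  have BltA : (#|B| < #|A|)%N.
    by apply: proper_card; apply/properP; split=> //; exists r.
  rewrite /g /= -cAB.
  under eq_bigr => p1 _.
    rewrite -cut_expect_sum_in.
    under [X in cut_expect_rec m _ X]funext => s.
      rewrite IH; [|by rewrite inE rB|by move=> j; rewrite inE => /andP[_ /rmin]|by rewrite cAB; lia].
      over.
    rewrite cut_expectZ; over.
  rewrite -mulr_sumr IH//; last by lia.
  by rewrite mulrCA mulrA.
rewrite sum_pointed split_expectS// mulr_suml mulr_sumr big_seq [RHS]big_seq.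
apply: eq_bigr => k; rewrite mem_index_iota => kA.
by rewrite [RHS]mulrA -binomial_weight// /g; set c := _^-1; ring.
Qed.

(** [cut_expect] divides by the number of edges, which is positive at each step. *)
Lemma cut_expect1 (R : realType) m r A p : p \in parent_maps r A -> r \in A ->
  (#|A| <= m)%N -> cut_expect_rec m (parent_graph A p) (fun=> 1 : R) = 1.
Proof.
elim: m r A p => [//|m IH] r A p pA rA Am.
have [A1|A1] := leqP #|A| 1; first by rewrite /= A1.
rewrite (cut_step m _ pA rA A1).
under eq_bigr => i /andP[iA ir].
  have b := descendants_block pA iA ir; have [DA iD rD piD Dp] := b.
  have rAD : r \in (A :\: descendants p i)%SET by rewrite finset.in_setD rD.
  have lt : (#|descendants p i| < #|A|)%N.
    by apply: proper_card; apply/properP; split=> //; exists r.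
  have lt' : (#|(A :\: descendants p i)%SET| < #|A|)%N.
    apply: proper_card; apply/properP; split; first exact: finset.subsetDl.
    by exists i => //; rewrite finset.in_setD iD.
  rewrite /=.
  under [X in cut_expect_rec m _ X]funext => s.
    rewrite (IH _ _ _ (block_restrict_out pA b) rAD); last first.
      by rewrite -ltnS; exact: leq_trans lt' Am.
    over.
  rewrite (IH _ _ _ (block_restrict_in pA b) iD); last first.
    by rewrite -ltnS; exact: leq_trans lt Am.
  over.
rewrite -(card_parent_edges pA rA) -sum1_card natr_sum (sum_parent_edges _ pA)/=.
rewrite divff// sumr_const pnatr_eq0 -lt0n.
have : (0 < #|A :\ r|)%SET%N by rewrite (cardsD1 r A) rA in A1.
by rewrite (cardsD1 r A) rA in A1; rewrite (_ : #|_| = #|(A :\ r)%SET|)//;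
  apply: eq_card => i; rewrite !inE andbC.
Qed.

End Splitting.

(** * Recursive trees are the trees of parent functions *)

Lemma shortest_path_uniq (V : finType) (e : rel V) x y s :
  shortest_path e x y s -> uniq (x :: s).
Proof.
move=> [es ls smin]; case: (shortenP es) ls => s' es' us' sub ls.
have le := smin s' es' ls.
by apply: (leq_size_uniq us') => //; move=> z; rewrite !inE => /orP[->//|/sub ->]; rewrite orbT.
Qed.

Lemma shortest_path_exists (V : finType) (e : rel V) x y :
  connect e x y -> exists s, shortest_path e x y s.
Proof.
move=> /connectP[s0 es0 ls0].
pose P k := `[< exists s, [/\ path e x s, last x s = y & size s = k] >].
have [k /asboolP[s [es ls sk]] kmin] := ex_minnP (ex_intro P (size s0)
  (asboolT (ex_intro _ s0 (And3 es0 (esym ls0) erefl)))).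
exists s; split=> // q eq lq; rewrite sk; apply: kmin; apply/asboolP.
by exists q.
Qed.

Section RecursiveTrees.
Variable n : nat.
Notation V := 'I_n.+1.
Notation r := (ord0 : V).
Implicit Types (p : {ffun V -> V}) (G : lgraph V).

(** A simple path that has gone up from [x] to a child of [x] can only leave that
child towards one of its own children: the parent has been visited. *)
Lemma parent_path_increasing p x s :
  p \in parent_maps r finset.setT -> path (adj (parent_edges p)) x s ->
  uniq (x :: s) -> p x \notin s -> path (fun i j : V => (i < j)%N) x s.
Proof.
move=> pA; have lp := parent_maps_le _ pA.
elim: s x => [//|y s IH] x /=.
rewrite parent_adjE => /andP[/andP[xy pxy] ps] /and3P[xs ys us].
rewrite inE negb_or => /andP[pxny pxs].
move: pxy; rewrite (negbTE pxny)/= => /eqP pyx.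
rewrite IH//=; last first.
- by rewrite pyx; apply: contra xs; rewrite inE orbC => ->.
- by rewrite ys us.
by rewrite andbT ltn_neqAle xy -pyx lp.
Qed.

(** On a cycle, both neighbours of the largest label would be its parent. *)
Lemma parent_acyclic p c : p \in parent_maps r finset.setT ->
  ucycle (adj (parent_edges p)) c -> (size c <= 2)%N.
Proof.
move=> pA /andP[cc uc]; rewrite leqNgt; apply/negP => c3.
have lp := parent_maps_le _ pA.
have [i0 i0c] : exists i0, i0 \in c by case: c c3 {cc uc} => // a *; exists a; rewrite inE eqxx.
pose x := [arg max_(x > i0 in c) (x : nat)].
have [xc xmax] : x \in c /\ forall j, j \in c -> (j <= x)%N by rewrite /x; case: arg_maxnP.
have [k s es] := rot_to xc.
have : cycle (adj (parent_edges p)) (x :: s) by rewrite -es rot_cycle.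
have : uniq (x :: s) by rewrite -es rot_uniq.
have : (2 < size (x :: s))%N by rewrite -es size_rot.
have {}xmax j : j \in s -> (j <= x)%N.
  by move=> js; apply: xmax; rewrite -(mem_rot k) es inE js orbT.
have down y : y \in s -> adj (parent_edges p) x y -> p x = y.
  move=> ys; rewrite parent_adjE => /andP[xy /orP[/eqP//|/eqP pyx]].
  move/eqP: xy; case; apply/val_inj/eqP; rewrite eqn_leq xmax// andbT.
  by rewrite -pyx lp.
case: s {es} xmax down => [//|y s]; case/lastP: s => [//|s z] xmax down _.
rewrite /= rcons_path last_rcons => /and3P[_ yz _] /andP[xy /andP[_ zx]].
have e1 : p x = y by apply: down xy; rewrite mem_head.
have e2 : p x = z.
  by apply: down; rewrite 1?adj_sym// inE mem_rcons mem_head orbT.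
by move: yz; rewrite -e1 e2 mem_rcons mem_head.
Qed.

Lemma parent_graph_recursive p : p \in parent_maps r finset.setT ->
  is_recursive_tree (parent_graph finset.setT p).
Proof.
move=> pA; split=> //.
  split=> /=.
  - by rewrite cardsT card_ord.
  - by move=> e /parent_edgesP[i pi ->]; rewrite cards2 eq_sym pi; split.
  - move=> x y _ _; have cr z := parent_connect pA (finset.in_setT z).
    apply: connect_trans (cr x) _.
    by rewrite (sym_connect_sym (@adj_sym _ _)).
  - by move=> c; exact: parent_acyclic pA.
move=> r' x s /= r'0 _ ss.
have {}r'0 : r' = r by exact/val_inj.
move: ss; rewrite r'0 => ss; have us := shortest_path_uniq ss.
case: ss => es _ _; apply: (parent_path_increasing pA es us).
have [_ h2] := parent_mapsP _ _ _ pA; rewrite h2 ?eqxx ?orbT//.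
by move: us => /andP[].
Qed.

Section Converse.
Variable G : lgraph V.
Hypothesis GR : is_recursive_tree G.
Let e : rel V := adj G.2.

Let esym : symmetric e. Proof. exact: adj_sym. Qed.

Let acyclic c : ucycle e c -> (size c <= 2)%N.
Proof. by case: GR => _ [_ _ _ h] _; apply: h. Qed.

Let conn x y : connect e x y.
Proof. by case: GR => VG [_ _ h _] _; apply: h; rewrite VG finset.in_setT. Qed.

Lemma shortest_path_mem v w s s' : shortest_path e r w s ->
  shortest_path e r v s' -> v \in r :: s -> v != w -> (size s' < size s)%N.
Proof.
move=> [es ls _] [_ _ s'min] vs vw; case/splitPl: vs es ls => s1 s2 l1.
rewrite cat_path last_cat l1 => /andP[es1 _] l2.
apply: leq_ltn_trans (s'min s1 es1 l1) _; rewrite size_cat -[X in (X < _)%N]addn0 ltn_add2l.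
by case: s2 l2 => // l2; rewrite -l2 eqxx in vw.
Qed.

(** Shortest paths from the root to [y] and to [z] avoid [x], because [y] and [z] are
not farther from the root than [x]; together with the edges from [x] to [y]
and to [z] they would contain a cycle if [y] and [z] were distinct. *)
Lemma unique_lower_neighbour x y z sx sy sz : shortest_path e r x sx ->
  shortest_path e r y sy -> shortest_path e r z sz ->
  e x y -> e x z -> (size sy <= size sx)%N -> (size sz <= size sx)%N -> y = z.
Proof.
move=> px py pz xy xz yx zx; apply/eqP; apply: contraT => yz.
pose e' : rel V := fun u v => [&& e u v, u != x & v != x].
have avoid w sw : e x w -> shortest_path e r w sw -> (size sw <= size sx)%N -> connect e' r w.
  move=> xw pw wx; have xsw : x \notin r :: sw.
    apply/negP => xsw; have := shortest_path_mem pw px xsw.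
    by case/andP: xw => -> _ /(_ isT); rewrite ltnNge wx.
  case: pw => es <- _; apply/connectP; exists sw => //.
  elim: sw (r) es xsw {wx} => [//|a s IH] b /= /andP[eba ps].
  rewrite !inE !negb_or => /and3P[xb xa xs].
  by rewrite /e' eba eq_sym xb eq_sym xa IH// inE negb_or xa.
have e'sym : symmetric e' by move=> u v; rewrite /e' esym andbCA andbC -!andbA [X in _ && X]andbC.
have : connect e' y z.
  apply: connect_trans (avoid z sz xz pz zx).
  by rewrite (sym_connect_sym e'sym); exact: avoid py yx.
move=> /connectP[s es lz]; case: (shortenP es) lz => s' es' us' _ lz.
have xs' : x \notin y :: s'.
  rewrite inE negb_or; case/andP: xy => -> _ /=.
  elim: s' (y) es' {us' lz} => [//|a s' IH] b /= /andP[/and3P[_ _ ax] /IH].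
  by rewrite inE negb_or eq_sym ax.
have : (size (x :: y :: s') <= 2)%N.
  apply: acyclic; apply/andP; split; last by rewrite /= xs'.
  rewrite /= xy rcons_path -lz esym xz andbT.
  by apply: sub_path es' => u v /and3P[].
by case: s' lz {es' us' xs'} => // zy; rewrite zy eqxx in yz.
Qed.

Lemma shortest_path_rcons v y s sy : shortest_path e r v s ->
  shortest_path e r y sy -> e v y -> (size s < size sy)%N ->
  shortest_path e r y (rcons s y).
Proof.
move=> [es ls smin] [_ _ symin] vy lt; split; rewrite ?last_rcons//.
  by rewrite rcons_path es ls.
by move=> q eq lq; rewrite size_rcons; apply: leq_trans lt _; exact: symin.
Qed.

(** The definition of recursive trees only speaks of paths to leaves. A vertex that
is not a leaf has two neighbours, and by [unique_lower_neighbour] one of them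
is farther from the root, so that a shortest path extends until it reaches a
leaf. *)
Lemma shortest_path_increasing v s : shortest_path e r v s ->
  path (fun i j : V => (i < j)%N) r s.
Proof.
have [m] := ubnP (n.+1 - size s); elim: m v s => // m IH v s sm ps.
case: (GR) => VG _ leafP.
have [lv|] := boolP (is_leaf G v); first exact: (leafP r v).
rewrite /is_leaf VG finset.in_setT/= -ltnNge => /card_gt1P[y [z]].
rewrite !inE => -[vy vz yz].
have [sy py] := shortest_path_exists (conn r y).
have [sz pz] := shortest_path_exists (conn r z).
have us : (size s < n.+1)%N.
  by have := shortest_path_uniq ps => /card_uniqP/= <-; rewrite -[X in (_ <= X)%N](card_ord n.+1) max_card.
have ext w sw : shortest_path e r w sw -> e v w -> (size s < size sw)%N ->
    path (fun i j : V => (i < j)%N) r s.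
  move=> pw vw lt; have sm' : (n.+1 - size (rcons s w) < m)%N.
    by rewrite size_rcons; move: sm us; clear; lia.
  have := IH w _ sm' (shortest_path_rcons ps pw vw lt).
  by rewrite rcons_path => /andP[].
have [|sys] := ltnP (size s) (size sy); first exact: ext py vy.
have [|szs] := ltnP (size s) (size sz); first exact: ext pz vz.
by move: yz; rewrite (unique_lower_neighbour ps py pz vy vz) ?eqxx.
Qed.

(** The parent is the neighbour of [v] on a shortest path from the root. Any other
neighbour is farther from the root than [v], hence comes after [v] on an
increasing path. *)
Lemma recursive_parent v : v != r -> exists u : V, [/\ e v u, (u < v)%N &
  forall y, e v y -> y != u -> (v < y)%N].
Proof.
move=> vr; have [s ps] := shortest_path_exists (conn r v).
case/lastP: s ps => [[_ /= rv]|s w ps]; first by rewrite rv eqxx in vr.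
have inc := shortest_path_increasing ps.
have wv : w = v by case: ps => _; rewrite last_rcons.
subst w; case: (ps) => es _ smin.
move: es inc; rewrite !rcons_path => /andP[es euv] /andP[_ uv].
exists (last r s); split=> //; first by rewrite esym.
move=> y vy yu; have [sy py] := shortest_path_exists (conn r y).
have [su pu] := shortest_path_exists (conn r (last r s)).
have [lt|le] := ltnP (size (rcons s v)) (size sy).
  have := shortest_path_increasing (shortest_path_rcons ps py vy lt).
  by rewrite rcons_path last_rcons => /andP[].
move: yu; rewrite (unique_lower_neighbour ps py pu vy _ le) ?eqxx//.
  by rewrite esym.
case: pu => _ _ sumin; rewrite size_rcons; apply: leq_trans (leqnSn _).
exact: sumin.
Qed.

Lemma recursive_parent_graph : exists2 p, p \in parent_maps r finset.setT &
  G = parent_graph finset.setT p.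
Proof.
have /choice[p pP] v : exists u : V, (v == r -> u = r) /\ (v != r ->
    [/\ e v u, (u < v)%N & forall y, e v y -> y != u -> (v < y)%N]).
  have [->|/recursive_parent[u ?]] := eqVneq v r; first by exists r.
  by exists u; split.
exists (finfun p).
  apply/parent_mapsP; split=> i.
    by move=> _ ir; rewrite finset.in_setT ffunE; have [] := (pP i).2 ir.
  by rewrite finset.in_setT/= ffunE => ir; rewrite (pP i).1// (eqP ir).
case: GR => VG [_ Gedge _ _] _.
rewrite [LHS]surjective_pairing VG /parent_graph; congr pair.
apply/finset.setP => f; apply/idP/parent_edgesP.
  move=> fG; have [/eqP/cards2P[x [y [xy fxy]]] _] := Gedge f fG; subst f.
  wlog lt : x y xy fG / (x < y)%N.
    move=> W; have [xy'|yx|/val_inj xy'] := ltngtP x y.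
    - exact: W xy'.
    - by rewrite finset.setUC; apply: W => //; rewrite 1?eq_sym// finset.setUC.
    - by rewrite xy' eqxx in xy.
  have yr : y != r by apply: contraTneq lt => ->.
  have [_ _ pmin] := (pP y).2 yr; exists y; rewrite ffunE; last first.
    rewrite finset.setUC; congr (_ |: [set _])%SET; apply/eqP; apply: contraT => xp.
    have yx : e y x by rewrite /e /adj eq_sym xy finset.setUC.
    by have := pmin x yx xp; rewrite ltnNge (ltnW lt).
  have [_ py _] := (pP y).2 yr.
  by apply: contraTneq py => ->; rewrite ltnn.
case=> i; rewrite ffunE => pi ->.
have ir : i != r by apply: contraNneq pi => ->; rewrite (pP r).1.
by have [/andP[]] := (pP i).2 ir.
Qed.

End Converse.

Lemma recursive_treesE : recursive_trees n.+1 =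
  [set parent_graph finset.setT p | p in parent_maps r finset.setT]%SET.
Proof.
apply/finset.setP => G; rewrite inE; apply/asboolP/imsetP.
  by move=> /recursive_parent_graph[p pA ->]; exists p.
by case=> p pA ->; exact: parent_graph_recursive.
Qed.

Lemma parent_graph_inj : {in parent_maps r finset.setT &,
  injective (parent_graph finset.setT)}.
Proof.
move=> p q pA qA [epq]; apply/ffunP => i.
have [h1 h2] := parent_mapsP _ _ _ pA; have [k1 k2] := parent_mapsP _ _ _ qA.
have [->|ir] := eqVneq i r; first by rewrite h2 ?k2 ?eqxx ?orbT.
have pi : p i != i by rewrite (parent_nonfix _ pA) finset.in_setT.
have : [set i; p i]%SET \in parent_edges q by rewrite -epq; apply/parent_edgesP; exists i.
case/parent_edgesP => j qj; rewrite eq_sym in pi.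
move=> /(set2_eq_cases pi)[[-> //]|[e1 e2]].
have := parent_maps_le i pA; have := parent_maps_le j qA; rewrite -e1 e2 => ij ji.
by move: qj; rewrite -e1; case/eqP; apply/val_inj/eqP; rewrite eqn_leq ij ji.
Qed.

Lemma sum_recursive_trees (R : realType) (f : tree -> R) :
  \sum_(G in recursive_trees n.+1) cut_expect G f = n`!%:R * split_expect n.+1 f.
Proof.
rewrite recursive_treesE big_imset/=; last exact: parent_graph_inj.
under eq_bigr do rewrite /cut_expect /= cardsT card_ord.
by rewrite sum_cut ?finset.in_setT// cardsT card_ord.
Qed.

End RecursiveTrees.

(** Obtained from [sum_recursive_trees] at the constant function 1, for which both
kinds of expectations are equal to 1. *)
Lemma card_recursive_trees (R : realType) n : #|recursive_trees n.+1|%:R = n`!%:R :> R.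
Proof.
rewrite -[RHS]mulr1 -[X in _ * X](@split_expect_cst R n.+1) -sum_recursive_trees.
rewrite -sum1_card natr_sum; apply: eq_bigr => G; rewrite recursive_treesE.
move=> /imsetP[p pA ->]; by rewrite /cut_expect /= (cut_expect1 _ pA)// finset.in_setT.
Qed.

Lemma sum_rrt_pmf (R : realType) n (f : tree -> R) :
  \sum_(G : lgraph 'I_n.+1) rrt_pmf R G * cut_expect G f = split_expect n.+1 f.
Proof.
rewrite (bigID (mem (recursive_trees n.+1)))/= [X in _ + X]big1 ?addr0; last first.
  by move=> G /negbTE GR; rewrite /rrt_pmf GR mul0r.
under eq_bigr => G GR do rewrite /rrt_pmf GR.
rewrite -mulr_sumr sum_recursive_trees card_recursive_trees mulrA mulVf ?mul1r//.
Qed.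

Local Open Scope classical_set_scope.
Local Open Scope ring_scope.

(** * The limit of the splitting recursion *)

Lemma cvg_rsum (R : realType) (I : Type) (s : seq I) (F : nat -> I -> R) (L : I -> R) :
  (forall i, F n i @[n --> \oo] --> L i) ->
  \sum_(i <- s) F n i @[n --> \oo] --> \sum_(i <- s) L i.
Proof.
by move=> h; apply: cvg_big => [|i _]; [exact: add_continuous|exact: h].
Qed.

Section Limit.
Variable R : realType.
Implicit Types (f g : tree -> R) (b : nat -> R) (M : R).

(** Partial sums of the expectation of [b] under [size_pmf]; the term [l = 0]
vanishes. *)
Definition mix_series b : R ^nat :=
  fun N => \sum_(0 <= l < N) size_pmf R l * b l.

Definition mix b : R := limn (mix_series b).

Lemma size_pmf_ge0 l : 0 <= size_pmf R l.
Proof. by rewrite /size_pmf invr_ge0. Qed.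

Lemma size_pmf_tail M b a N : (forall l, 0 <= b l <= M) -> (0 < a <= N)%N ->
  0 <= \sum_(a <= l < N) size_pmf R l * b l <= M / a%:R.
Proof.
move=> bM /andP[a0 aN]; apply/andP; split.
  by apply: sumr_ge0 => l _; rewrite mulr_ge0 ?size_pmf_ge0//; case/andP: (bM l).
have M0 : 0 <= M by case/andP: (bM 0%N) => h1 h2; exact: le_trans h2.
apply: (@le_trans _ _ (M * (a%:R^-1 - N%:R^-1))).
  rewrite -sum_inv_succ ?a0// mulr_sumr; apply: ler_sum => l _.
  by rewrite mulrC ler_wpM2r ?invr_ge0//; case/andP: (bM l).
by rewrite ler_wpM2l// gerBl invr_ge0.
Qed.

Lemma mix_series_split b a N : (a <= N)%N ->
  mix_series b N = mix_series b a + \sum_(a <= l < N) size_pmf R l * b l.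
Proof. by move=> aN; rewrite /mix_series (@big_cat_nat _ _ _ a). Qed.

Lemma mix_series_nd M b : (forall l, 0 <= b l <= M) ->
  {homo mix_series b : n m / (n <= m)%N >-> n <= m}.
Proof.
move=> bM n m nm; rewrite (mix_series_split _ nm) lerDl.
by apply: sumr_ge0 => l _; rewrite mulr_ge0 ?size_pmf_ge0//; case/andP: (bM l).
Qed.

Lemma mix_series1 b : mix_series b 1 = 0.
Proof. by rewrite /mix_series big_nat1 /size_pmf mul0n invr0 mul0r. Qed.

Lemma mix_series_le M b N : (forall l, 0 <= b l <= M) -> 0 <= mix_series b N <= M.
Proof.
move=> bM; have M0 : 0 <= M by case/andP: (bM 0%N) => h1 h2; exact: le_trans h2.
case: N => [|N]; first by rewrite /mix_series big_geq// lexx.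
rewrite (@mix_series_split b 1)// mix_series1 add0r.
by have := @size_pmf_tail M b 1 N.+1 bM isT; rewrite invr1 mulr1.
Qed.

Lemma mix_series_cvg M b : (forall l, 0 <= b l <= M) -> mix_series b @ \oo --> mix b.
Proof.
move=> bM; apply: nondecreasing_is_cvgn; first exact: mix_series_nd bM.
by exists M => _ [N _ <-]; case/andP: (mix_series_le N bM).
Qed.

Lemma mix_bound M b : (forall l, 0 <= b l <= M) -> 0 <= mix b <= M.
Proof.
move=> bM; have c := mix_series_cvg bM; apply/andP; split.
  by apply: limr_ge; [exact: cvgP c|near=> N; case/andP: (mix_series_le N bM)].
by apply: limr_le; [exact: cvgP c|near=> N; case/andP: (mix_series_le N bM)].
Unshelve. all: by end_near. Qed.

Lemma mix_tail M b a : (forall l, 0 <= b l <= M) -> (0 < a)%N ->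
  mix_series b a <= mix b <= mix_series b a + M / a%:R.
Proof.
move=> bM a0; have c := mix_series_cvg bM; apply/andP; split.
  by apply: nondecreasing_cvgn_le; [exact: mix_series_nd bM|exact: cvgP c].
apply: limr_le; first exact: cvgP c.
near=> N; have aN : (a <= N)%N by near: N; exact: nbhs_infty_ge.
by rewrite (mix_series_split _ aN) lerD2l; case/andP: (size_pmf_tail bM (introT andP (conj a0 aN))).
Unshelve. all: by end_near. Qed.

(** Dominated convergence for series: the tails beyond [K] are bounded by [M / K]
uniformly in [n]. *)
Lemma mix_tannery M (a : nat -> nat -> R) b :
  (forall n l, 0 <= a n l <= M) -> (forall l, 0 <= b l <= M) ->
  (forall l, a n l @[n --> \oo] --> b l) ->
  mix_series (a n) n @[n --> \oo] --> mix b.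
Proof.
move=> aM bM ab; have M0 : 0 <= M by case/andP: (bM 0%N) => h1 h2; exact: le_trans h2.
apply/cvgrPdist_le => eps eps0.
(* the tails beyond [K] contribute at most [M / K <= eps / 3] *)
pose K := (Num.bound (3 * M / eps)).+1.
have K0 : (0 < K)%N by [].
have MK : M / K%:R <= eps / 3.
  have : 3 * M / eps < K%:R.
    apply: (@lt_le_trans _ _ (Num.bound (3 * M / eps))%:R); last by rewrite ler_nat.
    by apply: archi_boundP; rewrite divr_ge0 ?mulr_ge0// ltW.
  by rewrite ltr_pdivrMr// ler_pdivrMr ?ltr0n// => h; lra.
have head : mix_series (a n) K @[n --> \oo] --> mix_series b K.
  apply: cvg_rsum => l.
  by apply: cvgM; [exact: cvg_cst|exact: ab].
have e3 : 0 < eps / 3 by rewrite divr_gt0.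
near=> n.
have Kn : (K <= n)%N by near: n; exact: nbhs_infty_ge.
have h1 : `|mix_series b K - mix_series (a n) K| <= eps / 3.
  by near: n; move/cvgrPdist_le: head; exact.
have /andP[h2 h3] := mix_tail bM K0.
rewrite (mix_series_split (a n) Kn).
have /andP[h4 h5] := size_pmf_tail (aM n) (introT andP (conj K0 Kn)).
move: h1; rewrite !ler_norml => /andP[h6 h7]; apply/andP; split; lra.
Unshelve. all: by end_near. Qed.

(** The expectation, in the limit tree, of a function of the tree cut at height [k]:
the branch of the limit tree is followed during [k] steps. *)
Fixpoint limit_expect k f : R :=
  if k is k'.+1 then
    mix (fun l => split_expect l (fun s => limit_expect k' (fun t => f (tjoin t s))))
  else f tleaf.

Lemma limit_expect_bound k M f : (forall t, 0 <= f t <= M) -> 0 <= limit_expect k f <= M.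
Proof.
elim: k f => [|k IH] f fM /=; first exact: fM.
apply: mix_bound => l.
by apply: split_expect_bound => s; apply: IH.
Qed.

Lemma trunc_measurable_tjoin T k (f : tree -> T) s : trunc_measurable k.+1 f ->
  trunc_measurable k (fun t => f (tjoin t s)).
Proof. by move=> fk t t' e; apply: fk; rewrite !trunc_tjoin e. Qed.

(** In [split_expectS], the subtree with [n - l] vertices converges by induction
since it is cut one level lower, while the subtree with [l] vertices is fixed;
the weight [split_weight n l] is [size_pmf l] times [n / (n - 1)]. *)
Lemma split_expect_cvg k M f : trunc_measurable k f -> (forall t, 0 <= f t <= M) ->
  split_expect n f @[n --> \oo] --> limit_expect k f.
Proof.
elim: k M f => [|k IH] M f fk fM.
  have -> : f = fun=> f tleaf by apply/funext => t; apply: fk; rewrite !trunc_height0.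
  by under eq_fun do rewrite split_expect_cst; exact: cvg_cst.
pose a n l := split_expect l (fun s => split_expect (n - l) (fun t => f (tjoin t s))) : R.
pose b l := split_expect l (fun s => limit_expect k (fun t => f (tjoin t s))) : R.
have aM n l : 0 <= a n l <= M.
  by apply: split_expect_bound => s; apply: split_expect_bound.
have bM l : 0 <= b l <= M.
  by apply: split_expect_bound => s; apply: limit_expect_bound.
have ab l : a n l @[n --> \oo] --> b l.
  apply: cvg_rsum => x.
  apply: cvgM; first exact: cvg_cst.
  have := IH M _ (trunc_measurable_tjoin x.2 fk) (fun=> fM _).
  by apply: cvg_comp; exact: cvg_subnr.
have nn : n%:R / n.-1%:R @[n --> \oo] --> (1 : R).
  have : 1 + harmonic n @[n --> \oo] --> (1 + 0 : R).
    by apply: cvgD; [exact: cvg_cst|exact: cvg_harmonic].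
  rewrite addr0 => h; rewrite -(cvg_shiftn 2); apply: cvg_trans h; apply: near_eq_cvg.
  near=> n; have n1 : (n.+1%:R != 0 :> R) by rewrite pnatr_eq0.
  rewrite /= /harmonic/= addn2/= -(natr1 n.+1) mulrDl divff//.
  by rewrite mul1r.
rewrite -[X in _ --> X]mul1r.
apply: cvg_trans (cvgM nn (mix_tannery aM bM ab)); apply: near_eq_cvg.
near=> n; have n2 : (1 < n)%N by near: n; exact: nbhs_infty_ge.
rewrite /= split_expectS// (@mix_series_split _ 1)//; last exact: ltnW.
rewrite mix_series1 add0r mulr_sumr; apply: eq_bigr => l _.
by rewrite /split_weight /size_pmf (natrM _ n.-1) invfM /a !mulrA.
Unshelve. all: by end_near. Qed.

End Limit.

(** * The laws of the cut-trees as measures *)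

Section TreeMeasures.
Variable R : realType.
Notation btree := (g_sigma_algebraType (@open (ltree R))).

Lemma trunc_set_measurable k (A : set btree) :
  trunc_measurable k (A : tree -> Prop) -> measurable A.
Proof. by move=> Ak; apply: sub_sigma_algebra; exact: trunc_open Ak. Qed.

Lemma trunc_measurable_preimage T U k (f : tree -> T) (B : T -> U) :
  trunc_measurable k f -> trunc_measurable k (fun t => B (f t)).
Proof. by move=> fk t s ts; rewrite (fk _ _ ts). Qed.

Lemma trunc_measurable_fun k d (U : measurableType d) (f : btree -> U) (D : set btree) :
  measurable D -> trunc_measurable k f -> measurable_fun D f.
Proof.
move=> mD fk _ B _; apply: measurableI => //; apply: (@trunc_set_measurable k).
exact: (trunc_measurable_preimage (B : U -> Prop) fk).
Qed.

Definition split_measure n : {measure set btree -> \bar R} :=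
  [the measure _ _ of msum (fun i => [the measure _ _ of
     mscale (`|(nth (0, tleaf) (split_law R n n) i).1|%:nng)
       [the measure _ _ of dirac ((nth (0, tleaf) (split_law R n n) i).2 : btree)]])
    (size (split_law R n n))].

Definition mix_measure : {measure set btree -> \bar R} :=
  [the measure _ _ of mseries (fun l => [the measure _ _ of
     mscale (`|size_pmf R l|%:nng) (split_measure l)]) 0].

Local Open Scope ereal_scope.

Lemma integral_split_measure n (f : btree -> R) : measurable_fun setT f ->
  (forall t, 0 <= f t)%R ->
  \int[split_measure n]_t (f t)%:E = (split_expect n (f : tree -> R))%:E.
Proof.
move=> mf f0; have mf' : measurable_fun setT (fun t => (f t)%:E) by exact/measurable_EFinP.
rewrite ge0_integral_measure_sum//; last by move=> t _; rewrite lee_fin.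
rewrite /split_expect (big_nth (0%R, tleaf)) big_mkord -sumEFin; apply: eq_bigr => i _.
rewrite ge0_integral_mscale//; last by move=> t _; rewrite lee_fin.
rewrite integral_dirac// diracT mul1e EFinM/= ger0_norm//.
by apply: (@split_law_ge0 R n n); rewrite mem_nth.
Qed.

Lemma mix_nneseries M b : (forall l, 0 <= b l <= M)%R ->
  \sum_(0 <= l <oo) (size_pmf R l * b l)%:E = (mix b)%:E.
Proof.
move=> bM; apply/cvg_lim => //.
under eq_fun do rewrite sumEFin.
by apply: cvg_EFin; [exact: nearW|exact: mix_series_cvg bM].
Qed.

Lemma integral_mix_measure M (f : btree -> R) : measurable_fun setT f ->
  (forall t, 0 <= f t <= M)%R ->
  \int[mix_measure]_t (f t)%:E = (mix (fun l => split_expect l (f : tree -> R)))%:E.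
Proof.
move=> mf fM; have f0 t : (0 <= f t)%R by case/andP: (fM t).
have mf' : measurable_fun setT (fun t => (f t)%:E) by exact/measurable_EFinP.
rewrite ge0_integral_measure_series//; last by move=> t _; rewrite lee_fin.
rewrite -(@mix_nneseries M); last by move=> l; exact: split_expect_bound.
apply: eq_eseriesr => l _; rewrite ge0_integral_mscale//; last by move=> t _; rewrite lee_fin.
by rewrite integral_split_measure// EFinM/= ger0_norm// size_pmf_ge0.
Qed.

Lemma indic_measurable (A : set btree) : measurable A -> measurable_fun setT (\1_A : btree -> R).
Proof. by move=> mA; exact: measurable_indic. Qed.

Lemma indic_bound (A : set btree) t : (0 <= (\1_A t : R) <= 1)%R.
Proof. by rewrite indicE; case: (_ \in _); rewrite ?lexx ?ler01. Qed.

Lemma split_measureE n (A : set btree) : measurable A ->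
  split_measure n A = (split_expect n (\1_A : tree -> R))%:E.
Proof.
move=> mA; have m1 := indic_measurable mA.
have ge0 t : (0 <= (\1_A t : R))%R by case/andP: (indic_bound A t).
rewrite -(integral_split_measure n m1 ge0).
by rewrite integral_indic// setIT.
Qed.

Lemma mix_measureE (A : set btree) : measurable A ->
  mix_measure A = (mix (fun l => split_expect l (\1_A : tree -> R)))%:E.
Proof.
move=> mA; have m1 := indic_measurable mA.
rewrite -(integral_mix_measure m1 (indic_bound A)).
by rewrite integral_indic// setIT.
Qed.

Lemma mix_cst (c : R) : mix (fun=> c) = c.
Proof.
apply/cvg_lim => //; rewrite -(cvg_shiftn 1) /=.
have : (c * (1 - harmonic n))%R @[n --> \oo] --> (c * (1 - 0))%R.
  by apply: cvgM; [exact: cvg_cst|apply: cvgB; [exact: cvg_cst|exact: cvg_harmonic]].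
rewrite subr0 mulr1; apply: cvg_trans; apply: near_eq_cvg; near=> n.
rewrite /= addn1 (@mix_series_split _ _ 1)// mix_series1 add0r -mulr_suml mulrC.
by rewrite sum_inv_succ// invr1.
Unshelve. all: by end_near. Qed.

(** Applying the inequality to the complement of [A] gives the converse
inequality. *)
Lemma le_probability_eq d (E : measurableType d) (mu : {measure set E -> \bar R})
   (P : probability E R) : mu setT = 1 ->
  (forall A, measurable A -> mu A <= P A) -> forall A, measurable A -> P A = mu A.
Proof.
move=> mu1 le A mA; have mC := measurableC mA.
have muA : mu A + mu (~` A) = 1.
  by rewrite -mu1 -(setUv A) measureU// setICr.
have PA : P A + P (~` A) = 1.
  by rewrite -(probability_setT P) -(setUv A) measureU// setICr.
have finP B : measurable B -> P B \is a fin_num.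
  by move=> mB; exact: fin_num_measure.
have fin B : measurable B -> mu B \is a fin_num.
  move=> mB; rewrite ge0_fin_numE//; apply: le_lt_trans (le _ mB) _.
  by rewrite -ge0_fin_numE// finP.
have := le _ mA; have := le _ mC; move: muA PA.
rewrite -(fineK (finP _ mA)) -(fineK (finP _ mC)) -(fineK (fin _ mA)) -(fineK (fin _ mC)).
by rewrite !lee_fin -!EFinD => -[h1] [h2] h3 h4; congr EFin; lra.
Qed.

End TreeMeasures.

Section Laws.
Variable R : realType.
Notation btree := (g_sigma_algebraType (@open (ltree R))).
Local Open Scope ereal_scope.

Lemma sum_finite_events_le d (Omega : measurableType d) (P : probability Omega R)
    (I : finType) (E : I -> set Omega) (A : set Omega) :
  (forall i, measurable (E i)) -> (forall i j w, E i w -> E j w -> i = j) ->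
  (forall i, E i `<=` A) -> measurable A -> \sum_(i : I) P (E i) <= P A.
Proof.
move=> mE dE EA mA.
have -> : \sum_(i : I) P (E i) = P (\bigcup_(i in [set: I]) E i).
  rewrite measure_fin_bigcup//; first last.
  - by move=> i j _ _ [w [Ei Ej]]; exact: dE Ei Ej.
  - exact: finite_finset.
  rewrite (fsbigE (index_enum I)) ?index_enum_uniq//.
    by apply: eq_bigl => i; rewrite in_setT.
  by move=> i _; rewrite mem_index_enum.
apply: le_measure; rewrite ?inE//.
- by apply: fin_bigcup_measurable => //; exact: finite_finset.
- by move=> w [i _ /EA].
Qed.

Lemma measurable_eq_preimage d (Omega : measurableType d) (Y : Omega -> labelled_graph) G :
  measurable_fun setT Y -> measurable [set w | Y w = G].
Proof. by move=> mY; rewrite -[X in measurable X]setTI; exact: (mY measurableT [set G]). Qed.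

Lemma labelled_inj n : injective (@labelled n).
Proof. by move=> G G' /eqP; rewrite eq_Tagged/= => /eqP. Qed.

(** The disjointness of the events [tau = labelled G] gives one inequality, and
[le_probability_eq] the other. *)
Lemma split_law_distribution d (Omega : measurableType d) (P : probability Omega R)
    (tau : Omega -> labelled_graph) (T : {mfun Omega >-> btree}) n :
  measurable_fun setT tau ->
  (forall (G : lgraph 'I_n.+1) (A : set btree), measurable A ->
    P [set w | tau w = labelled G /\ A (T w)] = (rrt_pmf R G * cut_prob G A)%:E) ->
  forall A, measurable A -> distribution P T A = split_measure R n.+1 A.
Proof.
move=> mtau lawT; apply: le_probability_eq.
  by rewrite split_measureE// indicT split_expect_cst.
move=> A mA; rewrite split_measureE// -sum_rrt_pmf.
have mTA : measurable (T @^-1` A) by exact: measurable_funPTI.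
apply: (@le_trans _ _ (\sum_(G : lgraph 'I_n.+1) P [set w | tau w = labelled G /\ A (T w)])).
  by rewrite -sumEFin; apply: lee_sum => G _; rewrite lawT.
apply: sum_finite_events_le => //.
- move=> G; apply: measurableI => //; exact: measurable_eq_preimage.
- by move=> G G' w /= [-> _] [/labelled_inj].
- by move=> G w [].
Qed.

Lemma mix_law_distribution d (Omega : measurableType d) (P : probability Omega R)
    (X : Omega -> nat) (theta : Omega -> labelled_graph) (C : {mfun Omega >-> btree}) :
  measurable_fun setT X -> measurable_fun setT theta ->
  (forall l (G : lgraph 'I_l) (A : set btree), measurable A ->
    P [set w | [/\ X w = l, theta w = labelled G & A (C w)]] =
    (size_pmf R l * rrt_pmf R G * cut_prob G A)%:E) ->
  forall A, measurable A -> distribution P C A = mix_measure R A.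
Proof.
move=> mX mtheta lawC; apply: le_probability_eq.
  rewrite mix_measureE// -[1]/(1%R%:E) -(mix_cst 1); congr (mix _)%:E.
  by apply/funext => l; rewrite indicT split_expect_cst.
move=> A mA; rewrite mix_measureE//.
have mCA : measurable (C @^-1` A) by exact: measurable_funPTI.
have mXl l : measurable [set w | X w = l].
  by rewrite -[X in measurable X]setTI; exact: (mX measurableT [set l]).
rewrite -(@mix_nneseries _ 1%R); last by move=> l; apply: split_expect_bound; exact: indic_bound.
rewrite [leRHS](_ : _ = P (\bigcup_l ([set w | X w = l] `&` C @^-1` A))); last first.
  rewrite /= /distribution /pushforward; congr (P _).
  by apply/seteqP; split=> [w Aw|w [l _ []]//]; exists (X w).
rewrite measure_bigcup; first last.
- by apply/trivIsetP => i j _ _ ij; rewrite -subset0 => w [[/= e1 _] [/= e2 _]]; rewrite -e1 -e2 eqxx in ij.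
- by move=> l _; exact: measurableI.
rewrite [leRHS](@eq_eseriesl _ _ xpredT); last by move=> i; rewrite in_setT.
apply: lee_nneseries.
  move=> l _ _; rewrite lee_fin mulr_ge0 ?size_pmf_ge0//.
  by case/andP: (split_expect_bound l (indic_bound A)).
case=> [|l] _; first by rewrite /size_pmf mul0n invr0 mul0r measure_ge0.
apply: (@le_trans _ _ (\sum_(G : lgraph 'I_l.+1)
   P [set w | [/\ X w = l.+1, theta w = labelled G & A (C w)]])).
  rewrite -sum_rrt_pmf mulr_sumr -sumEFin; apply: lee_sum => G _.
  by rewrite lawC// mulrA.
apply: sum_finite_events_le => //.
- move=> G; rewrite (_ : [set _ | _] = [set w | X w = l.+1] `&` [set w | theta w = labelled G] `&` C @^-1` A).
    by apply: measurableI => //; apply: measurableI => //; exact: measurable_eq_preimage.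
  by apply/seteqP; split=> w; [case|case; case].
- by move=> G G' w /= [_ -> _] [_ /labelled_inj].
- by move=> G w [].
- exact: measurableI.
Qed.

End Laws.

(** * Integrals over the infinite branch *)

Section Branch.
Variable R : realType.
Notation btree := (g_sigma_algebraType (@open (ltree R))).
Local Open Scope ereal_scope.
Variables (d : measure_display) (Omega : measurableType d) (P : probability Omega R)
  (C : nat -> {mfun Omega >-> btree}).

(** Events of this form carry the independence of [C 0], ..., [C m.-1] from the
remaining trees through the induction in [integral_fin_branch]. *)
Definition prefix_event m (A : nat -> set btree) : set Omega :=
  [set w | forall i, (i < m)%N -> A i (C i w)].

Hypothesis prefix_indep : forall m (A : nat -> set btree) B,
  (forall i, measurable (A i)) -> measurable B ->
  P (prefix_event m A `&` C m @^-1` B) = P (prefix_event m A) * P (C m @^-1` B).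
Hypothesis law : forall m A, measurable A -> P (C m @^-1` A) = mix_measure R A.

Definition code_rep k j : tree := xget tleaf [set t | trunc_code k t = j].

Lemma code_repE k t : trunc k (code_rep k (trunc_code k t)) = trunc k t.
Proof.
apply/trunc_codeE; rewrite /code_rep.
exact: (@xgetPex _ tleaf [set s | trunc_code k s = trunc_code k t] (ex_intro _ t erefl)).
Qed.

Definition code_set k j : set btree := [set t | trunc_code k t = j].

Lemma code_set_measurable k j : measurable (code_set k j).
Proof.
apply: (@trunc_set_measurable _ k) => t s /trunc_codeE ts; apply/propext.
by rewrite /code_set/= ts.
Qed.

Lemma code_event_measurable k m j : measurable (C m @^-1` code_set k j).
Proof. by apply: measurable_funPTI; exact: code_set_measurable. Qed.

(** On each piece, [C m] cut at height [k] is a constant tree. *)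
Lemma integral_codes k m (D : set Omega) (F : Omega -> R) : measurable D ->
  measurable_fun D F -> (forall w, 0 <= F w)%R ->
  \int[P]_(w in D) (F w)%:E =
  \sum_(0 <= j <oo) \int[P]_(w in D `&` C m @^-1` code_set k j) (F w)%:E.
Proof.
move=> mD mF F0.
have DE : D = \bigcup_j (D `&` C m @^-1` code_set k j).
  apply/seteqP; split=> [w Dw|w [j _ []]//]; by exists (trunc_code k (C m w)).
rewrite [in LHS]DE ge0_integral_bigcup//.
- by move=> j; apply: measurableI => //; exact: code_event_measurable.
- by rewrite -DE; exact/measurable_EFinP.
- by move=> w _; rewrite lee_fin.
- apply/trivIsetP => i j _ _ ij; rewrite -subset0 => w [[_ /= e1] [_ /= e2]].
  by rewrite -e1 -e2 eqxx in ij.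
Qed.

Lemma integral_attached m M (g : btree -> R) : measurable_fun setT g ->
  (forall t, 0 <= g t <= M)%R ->
  \int[P]_w (g (C m w))%:E = (mix (fun l => split_expect l (g : tree -> R)))%:E.
Proof.
move=> mg gM; rewrite -(integral_mix_measure mg gM).
rewrite -(@eq_measure_integral _ _ _ setT (mix_measure R) (distribution P (C m))).
  rewrite ge0_integral_pushforward//.
  - exact/measurable_EFinP.
  - by move=> t _; rewrite lee_fin; case/andP: (gM t).
by move=> A mA _; exact: law.
Qed.

Definition shifted m w : nat -> tree := fun i => C (m + i)%N w.

Lemma fin_branch_shift k m w : fin_branch k.+1 (shifted m w) =
  tjoin (fin_branch k (shifted m.+1 w)) (C m w).
Proof.
rewrite /=; congr tjoin; last by rewrite /shifted addn0.
by congr fin_branch; apply/funext => i; rewrite /shifted addSnnS.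
Qed.

Lemma fin_branch_set_measurable k m (B : tree -> Prop) : trunc_measurable k B ->
  measurable [set w | B (fin_branch k (shifted m w))].
Proof.
elim: k m B => [|k IH] m B Bk.
  have [Bl|Bl] := pselect (B tleaf).
    by rewrite (_ : [set w | _] = setT)//; apply/seteqP; split.
  by rewrite (_ : [set w | _] = set0)//; apply/seteqP; split.
rewrite (_ : [set w | _] = \bigcup_j (C m @^-1` code_set k j `&`
    [set w | B (tjoin (fin_branch k (shifted m.+1 w)) (code_rep k j))])).
  apply: bigcupT_measurable => j; apply: measurableI.
    exact: code_event_measurable.
  exact: (IH m.+1 _ (trunc_measurable_tjoin _ Bk)).
have BE w j : C m w \in code_set k j ->
    B (tjoin (fin_branch k (shifted m.+1 w)) (code_rep k j)) = B (fin_branch k.+1 (shifted m w)).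
  by rewrite inE fin_branch_shift => /= <-; apply: Bk; rewrite !trunc_tjoin code_repE.
apply/seteqP; split=> [w /= Bw|w [j _ [/mem_set jw]]].
  by exists (trunc_code k (C m w)) => //; split=> //=; rewrite BE// inE.
by rewrite /= (BE _ _ jw).
Qed.

Lemma fin_branch_measurable k m (D : set Omega) (f : tree -> R) : measurable D ->
  trunc_measurable k f -> measurable_fun D (fun w => f (fin_branch k (shifted m w))).
Proof.
move=> mD fk _ B mB; apply: measurableI => //.
exact: (fin_branch_set_measurable m (trunc_measurable_preimage (B : R -> Prop) fk)).
Qed.

Lemma prefix_event_measurable m A : (forall i, measurable (A i)) ->
  measurable (prefix_event m A).
Proof.
move=> mA; rewrite (_ : prefix_event m A = \bigcap_(i in [set i | (i < m)%N]) (C i @^-1` A i)) //.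
apply: bigcap_measurableType => i _; exact: measurable_funPTI.
Qed.

Lemma prefix_eventS m (A : nat -> set btree) B : prefix_event m A `&` C m @^-1` B =
  prefix_event m.+1 (fun i => if i == m then B else A i).
Proof.
apply/seteqP; split=> w /=.
  move=> [Aw Bw] i; rewrite ltnS leq_eqVlt; case: eqVneq => [->//|_] /=; exact: Aw.
move=> Aw; split=> [i im|].
  by have := Aw i (leqW im); rewrite (ltn_eqF im).
by have := Aw m (leqnn _); rewrite eqxx.
Qed.

(** On the event that [C m] has a given code, [C m] can be replaced by a fixed tree,
and the event itself extends the prefix event by one more coordinate. *)
Lemma integral_fin_branch k M (f : tree -> R) m A : trunc_measurable k f ->
  (forall t, 0 <= f t <= M)%R -> (forall i, measurable (A i)) ->
  \int[P]_(w in prefix_event m A) (f (fin_branch k (shifted m w)))%:E =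
  P (prefix_event m A) * (limit_expect k f)%:E.
Proof.
elim: k f m A => [|k IH] f m A fk fM mA.
  have := integral_cst P (prefix_event_measurable m mA) (f tleaf)%:E.
  by rewrite muleC.
have mS := prefix_event_measurable m mA.
pose g z := limit_expect k (fun t => f (tjoin t z)).
have fkz z : trunc_measurable k (fun t => f (tjoin t z)) by exact: trunc_measurable_tjoin.
have gM z : (0 <= g z <= M)%R by apply: limit_expect_bound.
have gk : trunc_measurable k g.
  move=> z z' zz'; rewrite /g; congr limit_expect; apply/funext => t; apply: fk.
  by rewrite !trunc_tjoin zz'.
have mg : measurable_fun (setT : set btree) (g : btree -> R) by exact: (trunc_measurable_fun measurableT gk).
rewrite (@integral_codes k m)//; last 2 first.
- exact: fin_branch_measurable.
- by move=> w; case/andP: (fM (fin_branch k.+1 (shifted m w))).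
have step j : \int[P]_(w in prefix_event m A `&` C m @^-1` code_set k j)
    (f (fin_branch k.+1 (shifted m w)))%:E =
    P (prefix_event m A) * \int[P]_(w in C m @^-1` code_set k j) (g (C m w))%:E.
  have -> : \int[P]_(w in C m @^-1` code_set k j) (g (C m w))%:E =
      P (C m @^-1` code_set k j) * (g (code_rep k j))%:E.
    rewrite -[RHS]muleC -integral_cst; last exact: code_event_measurable.
    apply: eq_integral => w; rewrite inE => /= <-; congr (_%:E); apply: gk.
    by rewrite code_repE.
  rewrite muleA -prefix_indep//; last exact: code_set_measurable.
  rewrite prefix_eventS -IH//.
    apply: eq_integral => w; rewrite -prefix_eventS inE => -[_ jw].
    have <- : trunc_code k (C m w) = j := jw.
    congr (_%:E); rewrite fin_branch_shift; apply: fk.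
    by rewrite !trunc_tjoin code_repE.
  by move=> i; case: ifP => // _; exact: code_set_measurable.
under eq_eseriesr do rewrite step.
rewrite -(fineK (fin_num_measure P _ mS)) nneseriesZl; last first.
  move=> j _; apply: integral_ge0 => w _; rewrite lee_fin; by case/andP: (gM (C m w)).
congr (_ * _); rewrite -(integral_attached m mg gM).
rewrite (@integral_codes k m setT)//.
- by apply: eq_eseriesr => j _; rewrite setTI.
- exact: measurableT_comp.
- by move=> w; case/andP: (gM (C m w)).
Qed.

Lemma integral_branch k M (f : tree -> R) : trunc_measurable k f ->
  (forall t, 0 <= f t <= M)%R ->
  \int[P]_w (f (tbranch (fun i => C i w)))%:E = (limit_expect k f)%:E.
Proof.
move=> fk fM; have := @integral_fin_branch k M f 0 (fun=> setT) fk fM (fun=> measurableT).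
rewrite (_ : prefix_event _ _ = setT); last by apply/seteqP; split.
rewrite probability_setT mul1e => <-; apply: eq_integral => w _; congr (_%:E).
by apply: fk; rewrite trunc_tbranch.
Qed.

(** An open set is the union over [k] of the union of the cylinders of height [k]
that it contains. *)
Lemma tbranch_measurable :
  measurable_fun setT (fun w => tbranch (fun i => C i w) : btree).
Proof.
apply: (@measurability _ _ Omega btree setT _ (@open (ltree R))) => // _ [U oU <-].
rewrite setTI.
pose V k : tree -> Prop := fun t => forall s, trunc k t = trunc k s -> U s.
have Vk k : trunc_measurable k (V k).
  by move=> t s ts; apply/propext; split=> h r e; apply: h; rewrite ?ts// -ts.
rewrite (_ : _ @^-1` _ = \bigcup_k [set w | V k (fin_branch k (shifted 0 w))]).
  by apply: bigcupT_measurable => k; exact: fin_branch_set_measurable.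
have VE k w : V k (fin_branch k (shifted 0 w)) = V k (tbranch (fun i => C i w)).
  by apply: Vk; rewrite trunc_tbranch.
apply/seteqP; split=> w /=.
  move=> Uw; have [k kU] : exists k, V k (tbranch (fun i => C i w)).
    have /nbhs_trunc[k kU] : nbhs (tbranch (fun i => C i w) : ltree R) U.
      by apply: open_nbhs_nbhs; split.
    by exists k.
  by exists k => //; change (V k (fin_branch k (shifted 0 w))); rewrite VE.
move=> [k _]; change (V k (fin_branch k (shifted 0 w)) -> U (tbranch (fun i => C i w))).
by rewrite VE; exact.
Qed.

End Branch.

(** * From cylinders to continuous functions *)

Section LowerEnvelope.
Variable R : realType.
Notation btree := (g_sigma_algebraType (@open (ltree R))).
Implicit Types (g : ltree R -> R) (t s : ltree R).

(** The largest function below [g] that only depends on the tree cut at height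
[k]. *)
Definition cylinder_inf k g t : R := inf [set g s | s in [set s : ltree R | trunc k s = trunc k t]].

Lemma cylinder_inf_trunc k g : trunc_measurable k (cylinder_inf k g).
Proof.
move=> t s ts; rewrite /cylinder_inf; congr inf.
by apply/seteqP; split=> _ [u /= ut <-]; exists u => //=; rewrite ut.
Qed.

Lemma cylinder_inf_le k g t s : (forall u, 0 <= g u) -> trunc k s = trunc k t ->
  cylinder_inf k g t <= g s.
Proof.
move=> g0 st; apply: ge_inf; last by exists s.
by exists 0 => _ [u _ <-].
Qed.

Lemma le_cylinder_inf k g t c : (forall s : ltree R, trunc k s = trunc k t -> c <= g s) ->
  c <= cylinder_inf k g t.
Proof.
move=> h; apply: lb_le_inf; first by exists (g t), t.
by move=> _ [s /= st <-]; exact: h.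
Qed.

Lemma cylinder_inf_bound k g M t : (forall u, 0 <= g u <= M) -> 0 <= cylinder_inf k g t <= M.
Proof.
move=> gM; have g0 u : 0 <= g u by case/andP: (gM u).
apply/andP; split; first by apply: le_cylinder_inf => s _.
by apply: le_trans (@cylinder_inf_le k g t t g0 erefl) _; case/andP: (gM t).
Qed.

Lemma cylinder_inf_nd g t : (forall u, 0 <= g u) ->
  {homo (fun k => cylinder_inf k g t) : n m / (n <= m)%N >-> n <= m}.
Proof.
move=> g0 n m nm; apply: le_cylinder_inf => s st; apply: cylinder_inf_le => //.
exact: trunc_le nm st.
Qed.

Lemma cylinder_inf_cvg g t : continuous g -> (forall u, 0 <= g u) ->
  cylinder_inf k g t @[k --> \oo] --> g t.
Proof.
move=> cg g0; apply/cvgrPdist_le => e e0.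
have /cvgrPdist_le/(_ _ e0)/nbhs_trunc[k kP] := cg t.
near=> n; have kn : (k <= n)%N by near: n; exact: nbhs_infty_ge.
have h1 := @cylinder_inf_le n g t t g0 erefl.
rewrite ger0_norm ?subr_ge0// lerBlDl -lerBlDr.
apply: le_cylinder_inf => s st; have := kP s (trunc_le kn (esym st)).
by move=> /ler_normlW; rewrite lerBlDl -lerBlDr.
Unshelve. all: by end_near. Qed.

Lemma continuous_tree_measurable (g : btree -> R) : continuous (g : ltree R -> R) ->
  measurable_fun setT g.
Proof.
move=> /continuousP cg; apply: (measurability _ (RGenOpens.measurableE R)).
move=> _ [_ [a [b ->]] <-]; rewrite setTI; apply: sub_sigma_algebra.
by apply: cg; exact: interval_open.
Qed.

End LowerEnvelope.

Section Convergence.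
Variable R : realType.
Notation btree := (g_sigma_algebraType (@open (ltree R))).
Local Open Scope ereal_scope.

Section BoundedIntegral.
Variables (d : measure_display) (Omega : measurableType d) (P : probability Omega R).

Lemma integral_bounded (h : Omega -> R) M : measurable_fun setT h ->
  (forall w, `|h w| <= M)%R -> exists a : R,
  [/\ \int[P]_w (h w)%:E = a%:E, \int[P]_w (h w + M)%:E = (a + M)%:E &
      \int[P]_w (M - h w)%:E = (M - a)%:E].
Proof.
move=> mh hM; have ih : P.-integrable setT (EFin \o h).
  apply: measurable_bounded_integrable => //.
    by rewrite -ge0_fin_numE// fin_num_measure.
  by exists M; split; [exact: num_real|move=> x Mx w _; exact: le_trans (hM w) (ltW Mx)].
have iM : P.-integrable setT (EFin \o (fun=> M) : Omega -> \bar R).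
  apply: measurable_bounded_integrable => //.
    by rewrite -ge0_fin_numE// fin_num_measure.
  by exists `|M|%R; split; [exact: num_real|move=> x Mx w _; exact: ltW].
have eM : \int[P]_w (M%:E) = M%:E.
  transitivity (M%:E * P setT); first exact: integral_cst.
  by rewrite probability_setT mule1.
have fh := integrable_fin_num measurableT ih.
exists (fine (\int[P]_w (h w)%:E)); rewrite fineK//; split=> //.
- under eq_integral do rewrite EFinD.
  rewrite (integralD_EFin measurableT ih iM)/= eM EFinD fineK//.
- under eq_integral do rewrite EFinB.
  by rewrite (integralB_EFin measurableT iM ih) eM EFinB fineK.
Qed.

End BoundedIntegral.

Variables (d : nat -> measure_display) (Omega : forall n, measurableType (d n))
  (P : forall n, probability (Omega n) R) (T : forall n, {mfun Omega n >-> btree})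
  (dlim : measure_display) (Omegalim : measurableType dlim)
  (Plim : probability Omegalim R) (Tlim : Omegalim -> btree).
Hypotheses (mTlim : measurable_fun setT Tlim)
  (intT : forall n k M (f : tree -> R), trunc_measurable k f ->
    (forall t, 0 <= f t <= M)%R ->
    \int[P n.+1]_w (f (T n.+1 w))%:E = (split_expect n.+1 f)%:E)
  (intTlim : forall k M (f : tree -> R), trunc_measurable k f ->
    (forall t, 0 <= f t <= M)%R ->
    \int[Plim]_w (f (Tlim w))%:E = (limit_expect k f)%:E).

(** [g] is bounded below by its infima over cylinders, whose expectations converge
as [n] grows by [split_expect_cvg]; they increase to [g] by continuity. *)
Lemma lower_limit (g : ltree R -> R) M eps a (b : nat -> R) : continuous g ->
  (forall t, 0 <= g t <= M)%R -> (0 < eps)%R ->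
  \int[Plim]_w (g (Tlim w))%:E = a%:E ->
  (forall n, \int[P n]_w (g (T n w))%:E = (b n)%:E) ->
  \forall n \near \oo, (a - eps <= b n)%R.
Proof.
move=> cg gM eps0 ea eb.
have g0 t : (0 <= g t)%R by case/andP: (gM t).
pose gk k := cylinder_inf k g : btree -> R.
have gkM k t : (0 <= gk k t <= M)%R by exact: cylinder_inf_bound.
have gkm k : trunc_measurable k (gk k) by exact: cylinder_inf_trunc.
have gk0 k t : (0 <= gk k t)%R by case/andP: (gkM k t).
have mgk k : measurable_fun setT (gk k) by exact: (trunc_measurable_fun measurableT (gkm k)).
have mg : measurable_fun setT (g : btree -> R) by exact: continuous_tree_measurable.
have cl : limit_expect k (gk k) @[k --> \oo] --> a.
  have h : \int[Plim]_w (gk k (Tlim w))%:E @[k --> \oo] --> a%:E.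
    rewrite (_ : a%:E = \int[Plim]_w limn (fun k => (gk k (Tlim w))%:E)).
      apply: cvg_monotone_convergence => //.
      - by move=> k; apply/measurable_EFinP; apply: measurableT_comp.
      - by move=> k w _; rewrite lee_fin.
      - by move=> w _ n m nm; rewrite lee_fin; exact: cylinder_inf_nd.
    rewrite -ea; apply: eq_integral => w _; apply/esym/cvg_lim => //.
    by apply: cvg_EFin; [exact: nearW|exact: cylinder_inf_cvg].
  have e : (fun k => \int[Plim]_w (gk k (Tlim w))%:E) = EFin \o (fun k => limit_expect k (gk k)).
    by apply/funext => k; exact: (intTlim (gkm k) (gkM k)).
  by move: h; rewrite e => /fine_cvgP[_].
have e2 : (0 < eps / 2)%R by rewrite divr_gt0.
have [k _ /(_ k (leqnn k))/= hk] : \forall k \near \oo, (`|a - limit_expect k (gk k)| <= eps / 2)%R.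
  by move/cvgrPdist_le: cl; exact.
have cs := split_expect_cvg (gkm k) (gkM k).
near=> n.
have n1 : (0 < n)%N by near: n; exact: nbhs_infty_gt.
have hn : (`|limit_expect k (gk k) - split_expect n (gk k : tree -> R)| <= eps / 2)%R.
  by near: n; move/cvgrPdist_le: cs; exact.
have le : (split_expect n (gk k : tree -> R) <= b n)%R.
  rewrite -lee_fin -eb -(prednK n1) -(intT _ (gkm k) (gkM k)).
  apply: ge0_le_integral => //.
  - by move=> w _; rewrite lee_fin.
  - by apply/measurable_EFinP; apply: measurableT_comp.
  - by apply/measurable_EFinP; apply: measurableT_comp.
  - by move=> w _; rewrite lee_fin; exact: cylinder_inf_le.
move: hk hn; rewrite !ler_norml => /andP[h1 h2] /andP[h3 h4]; lra.
Unshelve. all: by end_near. Qed.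

(** [lower_limit] for [f + M] bounds the lower limit, and for [M - f] the upper
limit. *)
Lemma expectation_cvg (f : ltree R -> R) M : continuous f ->
  (forall t, `|f t| <= M)%R ->
  \int[P n]_w (f (T n w))%:E @[n --> \oo] --> \int[Plim]_w (f (Tlim w))%:E.
Proof.
move=> cf fM.
have mf : measurable_fun setT (f : btree -> R) by exact: continuous_tree_measurable.
have mfT n : measurable_fun setT (fun w => f (T n w)) by exact: measurableT_comp.
have mfTl : measurable_fun setT (fun w => f (Tlim w)) by exact: measurableT_comp.
have [a [ea ea1 ea2]] := integral_bounded Plim mfTl (fun w => fM (Tlim w)).
have /choice[b bP] n : exists b : R, [/\ \int[P n]_w (f (T n w))%:E = b%:E,
    \int[P n]_w (f (T n w) + M)%:E = (b + M)%:E &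
    \int[P n]_w (M - f (T n w))%:E = (M - b)%:E].
  exact: (integral_bounded (P n) (mfT n) (fun w => fM (T n w))).
rewrite ea; have -> : (fun n => \int[P n]_w (f (T n w))%:E) = EFin \o b.
  by apply/funext => n; case: (bP n).
apply: cvg_EFin; first exact: nearW.
apply/cvgrPdist_le => e e0; rewrite /=.
have fM2 t : (0 <= f t + M <= M + M)%R.
  by have := fM t; rewrite ler_norml => /andP[h1 h2]; apply/andP; split; lra.
have fM3 t : (0 <= M - f t <= M + M)%R.
  by have := fM t; rewrite ler_norml => /andP[h1 h2]; apply/andP; split; lra.
have c1 : continuous (fun t => f t + M)%R.
  by move=> t; exact: (cvgD (cf t) (cvg_cst _)).
have c2 : continuous (fun t => M - f t)%R.
  by move=> t; exact: (cvgB (cvg_cst _) (cf t)).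
have eb1 n : \int[P n]_w (f (T n w) + M)%:E = (b n + M)%:E by case: (bP n).
have eb2 n : \int[P n]_w (M - f (T n w))%:E = (M - b n)%:E by case: (bP n).
have l1 := lower_limit c1 fM2 e0 ea1 eb1.
have l2 := lower_limit c2 fM3 e0 ea2 eb2.
near=> n.
have h1 : (a + M - e <= b n + M)%R by near: n.
have h2 : (M - a - e <= M - b n)%R by near: n.
by rewrite ler_norml; apply/andP; split; lra.
Unshelve. all: by end_near. Qed.

End Convergence.

(** * The theorem *)

Fixpoint initial_fset m : {fset nat} :=
  if m is m'.+1 then (m' |` initial_fset m')%fset else fset0.

Lemma in_initial_fset m i : (i \in initial_fset m) = (i < m)%N.
Proof.
elim: m => [|m IH]; first by rewrite in_fset0.
by rewrite in_fset1U IH [RHS]ltnS [RHS]leq_eqVlt.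
Qed.

(** Both sides are products of the probabilities of the single coordinates. *)
Lemma prefix_independent (R : realType) d d' (Omega : measurableType d)
    (F : measurableType d') (P : probability Omega R) (Y : nat -> Omega -> F)
    (C : nat -> {mfun Omega >-> g_sigma_algebraType (@open (ltree R))})
    (h : F -> g_sigma_algebraType (@open (ltree R))) :
  measurable_fun setT h -> (forall k w, h (Y k w) = C k w) ->
  mutually_independent P Y ->
  forall m (A : nat -> set (g_sigma_algebraType (@open (ltree R)))) B,
  (forall i, measurable (A i)) -> measurable B ->
  (P (prefix_event C m A `&` C m @^-1` B) = P (prefix_event C m A) * P (C m @^-1` B))%E.
Proof.
move=> mh hY ind m A B mA mB.
have mhA (S : set (g_sigma_algebraType (@open (ltree R)))) : measurable S -> measurable (h @^-1` S).
  by move=> mS; rewrite -[X in measurable X]setTI; exact: mh.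
have prefE l (S : nat -> set (g_sigma_algebraType (@open (ltree R)))) :
    (forall i, measurable (S i)) ->
    P (prefix_event C l S) = (\prod_(i <- initial_fset l) P (C i @^-1` S i))%E.
  move=> mS; have := ind (initial_fset l) (fun i => h @^-1` S i) (fun i => mhA _ (mS i)).
  have YE i : Y i @^-1` (h @^-1` S i) = C i @^-1` S i.
    by apply/seteqP; split=> w /=; rewrite hY.
  under eq_bigr do rewrite YE.
  move=> <-; congr (P _); apply/seteqP; split=> w /= Sw i.
    by rewrite /= in_initial_fset => /Sw; rewrite /= -hY.
  by move=> il; rewrite -hY; apply: Sw; rewrite /= in_initial_fset.
rewrite prefix_eventS prefE; last by move=> i; case: ifP.
rewrite /= big_fsetU1 ?in_initial_fset ?ltnn//= eqxx muleC; congr (_ * _)%E.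
rewrite prefE//; apply: eq_big_seq => i; rewrite in_initial_fset => im.
by rewrite (ltn_eqF im).
Qed.

Theorem proposition5p11 (R : realType)
  (* tau_n and T_n = Cut(tau_n), for n >= 1 *)
  (d : nat -> measure_display) (Omega : forall n, measurableType (d n))
  (P : forall n, probability (Omega n) R)
  (tau : forall n, {RV (P n) >-> labelled_graph})
  (T : forall n, {RV (P n) >-> borel (ltree R)})
  (lawT : forall n, (1 <= n)%N ->
    forall (G : lgraph 'I_n) (A : set (borel (ltree R))), measurable A ->
    P n [set w | tau n w = labelled G /\ A (T n w)] =
    (rrt_pmf R G * cut_prob G A)%:E)
  (* X_k, theta_k and C_k = Cut(theta_k), for k >= 0 *)
  (dlim : measure_display) (Omegalim : measurableType dlim)
  (Plim : probability Omegalim R)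
  (X : nat -> {RV Plim >-> nat})
  (theta : nat -> {RV Plim >-> labelled_graph})
  (C : nat -> {RV Plim >-> borel (ltree R)})
  (lawC : forall k l (G : lgraph 'I_l) (A : set (borel (ltree R))),
    measurable A ->
    Plim [set w | [/\ X k w = l, theta k w = labelled G & A (C k w)]] =
    (size_pmf R l * rrt_pmf R G * cut_prob G A)%:E)
  (indep : mutually_independent Plim
    (fun k w => (X k w, theta k w, C k w))) :
  cvg_in_distribution (S := ltree R) P (fun n w => T n w)
    Plim (fun w => tbranch (fun k => C k w)).
Proof.
have mtb : measurable_fun setT (fun w => tbranch (fun k => C k w) : borel (ltree R)).
  exact: (tbranch_measurable C).
split.
- by apply: nearW => n; exact: measurable_funPT.
- exact: mtb.
move=> f cf [M fM].
have EE dO (O : measurableType dO) (Q : probability O R) (h : O -> R) :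
  ('E_Q[h] = \int[Q]_w (h w)%:E)%E by rewrite unlock.
rewrite EE; under eq_fun do rewrite EE.
apply: (@expectation_cvg R d Omega P T dlim Omegalim Plim _ mtb _ _ f M cf fM).
- move=> n k N g gk gN.
  have mg : measurable_fun setT (g : borel (ltree R) -> R) by exact: (trunc_measurable_fun measurableT gk).
  have g0 t : 0 <= g t by case/andP: (gN t).
  rewrite -(integral_split_measure n.+1 mg g0).
  rewrite -(@eq_measure_integral _ _ _ setT (split_measure R n.+1) (distribution (P n.+1) (T n.+1))).
    rewrite ge0_integral_pushforward//.
    + exact/measurable_EFinP.
    + by move=> t _; rewrite lee_fin.
  move=> A mA _; apply: (split_law_distribution (tau := tau n.+1)) => //.
  by move=> G S mS; exact: lawT.
- move=> k N g gk gN; apply: (integral_branch (C := C) _ _ gk gN).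
  + apply: (prefix_independent (h := snd) _ _ indep) => //.
  + move=> m A mA; apply: (mix_law_distribution (X := X m) (theta := theta m)) => //.
    by move=> l G S mS; exact: lawC.
Qed.
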